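(* Consider a family $\mathbb\Psi=\{\Psi_i,\ i\in I\}\in\mathcal B$ and let $X$ be a strictly positive $(\mathcal F_t)$-progressive process. Also, define $$h(\overline p)=\frac{\overline p^{1+\beta}}{\mathscr I[\mathbb\Psi](\overline p)},\quad \varphi(\overline x)=\bigl(\mathscr I[\mathbb\Psi]\circ h^{\rm inv}\bigr)(\overline x)\quad\text{and}\quad \Phi_i(\overline x)=\Psi_i\Bigl(\bigl(\overline x\,\varphi(\overline x)\bigr)^{1/(1+\beta)}\Bigr),$$ where $h^{\rm inv}$ denotes the inverse of $h$. The following statements hold true. (I) The family $\mathbb\Phi=\{\Phi_i,\ i\in I\}$ belongs to $\mathcal B$. Furthermore, the function $\varphi$ is such that $\varphi=\mathscr I[\mathbb\Phi]$, $$\bigl(\overline x\,\varphi(\overline x)\bigr)'_->0 \quad\text{and}\quad \lim_{\overline x\uparrow\infty}\overline x\,\varphi(\overline x)=\infty .$$ (II) There exists a unique strictly positive $(\mathcal F_t)$-progressive process $P$ such that $$P^{1+\beta}=X\,\mathscr I[\mathbb\Psi](\overline P),\qquad\text{where }\overline P_t=\sup_{0\le s\le t}P_s .$$ This process is given by $$P=\bigl(X\,\mathscr I[\mathbb\Phi](\overline X)\bigr)^{1/(1+\beta)},\qquad\text{where }\overline X_t=\sup_{0\le s\le t}X_s .$$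
   Context: $(\Omega,\mathcal F,(\mathcal F_t),\mathsf P)$ is a filtered probability space supporting a standard one-dimensional $(\mathcal F_t)$-Brownian motion. $(I,\mathcal I,\iota)$ is a $\sigma$-finite measure space with $\iota$ non-atomic; in particular, $\{i\}\in\mathcal I$ and $\iota(\{i\})=0$ for all $i\in I$. $\beta>0$ and $\delta>0$ are constants and $\gamma=(1+\beta)/(\delta+\beta)\in\,]0,1[$. The functions $i\mapsto c_i$, $i\mapsto\alpha_i$ and $i\mapsto\lambda_i$ are strictly positive and $\mathcal I$-measurable on $I$, $\alpha_i\in\,]0,1[$ for all $i\in I$, and $\kappa_0:=(1+\beta)\int_I\lambda_ic_i^{\alpha_i}\,\iota(\mathrm di)<\infty$. Write $\mathbb R_+=[0,\infty[$. A function $f:\mathbb R_+\to\mathbb R$ is the difference of two convex functions if and only if it is absolutely continuous with left-hand derivative that is a function of finite variation; $f'_-$ denotes its left-hand first derivative. The set $\mathcal B$ consists of all families of functions $\mathbb X=\{\mathcal X_i,\ i\in I\}$ such that: (i) the function $\mathbb R_+\times I\ni(z,i)\mapsto\mathcal X_i(z)$ is $\mathcal B(\mathbb R_+)\otimes\mathcal I$-measurable, where $\mathcal B(\mathbb R_+)$ is the Borel $\sigma$-algebra on $\mathbb R_+$; (ii) $\int_I\lambda_i\mathcal X_i^{\alpha_i}(z)\,\iota(\mathrm di)<\infty$ for all $z>0$; and (iii) given any $i\in I$, $\mathcal X_i$ is the difference of two convex functions such that $\lim_{z\downarrow0}\mathcal X_i(z)=0$, $\lim_{z\uparrow\infty}\mathcal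 X_i(z)=\infty$ and $(\mathcal X_i)'_-(z)>0$ for all $z>0$. For $\mathbb X=\{\mathcal X_i,\ i\in I\}\in\mathcal B$, the operator $\mathscr I$ is defined by $$\mathscr I[\mathbb X](z)=\Bigl((1+\beta)\int_I\lambda_i\bigl(c_i^{\alpha_i}\vee\mathcal X_i^{\alpha_i}(z)\bigr)\,\iota(\mathrm di)\Bigr)^{-\gamma},\quad z\ge0 .$$
   Formalization: Φ∈B and (xφ(x))'_->0 are proved assuming I[Ψ] is a difference of two convex functions (Φ∈B can fail otherwise); also assumed: (F_t) contains all P-negligible sets, X has finite running supremum, ι(I)>0. P̄ finite is part of the equation. *)

(* Defs.v *)
From HB Require Import structures.
From mathcomp Require Import all_boot all_order all_algebra.
From mathcomp Require Import all_classical all_reals all_analysis.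
Import Order.TTheory GRing.Theory Num.Theory.
Import numFieldNormedType.Exports.

Set Implicit Arguments.
Unset Strict Implicit.
Unset Printing Implicit Defensive.

Local Open Scope classical_set_scope.
Local Open Scope ring_scope.

(** A function on [0, +oo[ is represented by a function [R -> R] of which only
    the values on [`[0, +oo[] are ever used. *)

Section functions_on_Rplus.
Variable R : realType.

(** Convex functions on [0, +oo[ are taken continuous at 0 (they are so on
    ]0, +oo[): this is what makes their differences absolutely continuous on
    compact subsets of [0, +oo[. The slope at 0 may be infinite, as for
    [z |-> - sqrt z]. *)
Definition convex_on_Rplus (g : R -> R) :=
  @convex_function R R^o `[0, +oo[ g /\ {within `[0, +oo[, continuous g}.

Definition diff_of_convex (f : R -> R) :=
  exists g k : R -> R, [/\ convex_on_Rplus g, convex_on_Rplus k &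
    forall z, 0 <= z -> f z = g z - k z].

Definition has_left_derivative (f : R -> R) (x l : R) :=
  (f y - f x) / (y - x) @[y --> x^'-] --> l.

Definition left_derivative_gt0 (f : R -> R) (x : R) :=
  exists2 l, 0 < l & has_left_derivative f x l.

End functions_on_Rplus.

Section families.
Context {d : measure_display} {I : measurableType d} {R : realType}.

(** Besides having null measurable singletons, [iota] has no atoms. *)
Definition non_atomic (iota : set I -> \bar R) :=
  (forall i, measurable [set i] /\ iota [set i] = 0%E) /\
  (forall A, measurable A -> (0 < iota A)%E ->
    exists B, [/\ measurable B, B `<=` A & (0 < iota B < iota A)%E]).

(** The set of families B. *)
Definition in_B (iota : {measure set I -> \bar R}) (alpha lambda : I -> R)
    (X : I -> R -> R) :=
  [/\ measurable_fun ((`[0, +oo[%classic : set R) `*` [set: I])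
        (fun zi : R * I => X zi.2 zi.1),
      forall z, 0 < z ->
        (\int[iota]_i (lambda i * X i z `^ alpha i)%:E < +oo)%E &
      forall i, [/\ diff_of_convex (X i),
                    X i z @[z --> 0^'+] --> 0,
                    X i z @[z --> +oo] --> +oo &
                    forall z, 0 < z -> left_derivative_gt0 (X i) z]].

(** The operator I; [gamma] is kept as a parameter. *)
Definition opI (iota : {measure set I -> \bar R}) (c alpha lambda : I -> R)
    (beta gamma : R) (X : I -> R -> R) (z : R) : R :=
  ((1 + beta) * \int[iota]_i
     (lambda i * Num.max (c i `^ alpha i) (X i z `^ alpha i))) `^ (- gamma).

End families.

Section processes.
Context {d : measure_display} {Omega : measurableType d} {R : realType}.
Variables (Pr : probability Omega R) (F : R -> set (set Omega)).

Definition filtration :=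
  [/\ forall t, 0 <= t -> sigma_algebra [set: Omega] (F t),
      forall t, 0 <= t -> F t `<=` measurable &
      forall s t, 0 <= s -> s <= t -> F s `<=` F t].

Definition complete_filtration :=
  forall t, 0 <= t -> Pr.-negligible `<=` F t.

(** A process is a function of time, meaningful for nonnegative times, and of
    the outcome. [W] is a standard Brownian motion relative to [F]. *)
Definition brownian_motion (W : R -> Omega -> R) :=
  [/\ forall t, 0 <= t -> forall B, measurable B -> F t (W t @^-1` B),
      {ae Pr, forall w, W 0 w = 0},
      {ae Pr, forall w, {within `[0, +oo[, continuous (W^~ w)}} &
      forall s t A B, 0 <= s -> s < t -> F s A -> measurable B ->
        Pr (A `&` (fun w => W t w - W s w) @^-1` B)
        = (Pr A * normal_prob 0 (Num.sqrt (t - s)) B)%E].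

(** On [`[0, t] * Omega], measurability is with respect to the product of the
    Borel sigma-algebra and [F t], which is a sigma-algebra. *)
Definition progressive (X : R -> Omega -> R) :=
  forall t, 0 <= t ->
    measurable_fun
      ((`[0, t]%classic : set R) `*` [set: g_sigma_algebraType (F t)])
      (fun sw : R * g_sigma_algebraType (F t) => X sw.1 sw.2).

Definition positive_process (X : R -> Omega -> R) :=
  forall t w, 0 <= t -> 0 < X t w.

(** [sup] is a junk value on unbounded sets, hence [locally_bounded_above]. *)
Definition run_sup (X : R -> Omega -> R) (t : R) (w : Omega) : R :=
  sup [set X s w | s in `[0, t]].

Definition locally_bounded_above (X : R -> Omega -> R) :=
  forall t w, 0 <= t -> has_ubound [set X s w | s in `[0, t]].

(** Strictly positive progressive [P] with [P^(1+beta) = X f(sup P)]; that the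
    running supremum of [P] is finite is part of the meaning of the equation,
    as [f] is a function on [0, +oo[. *)
Definition solves (beta : R) (f : R -> R) (X P : R -> Omega -> R) :=
  [/\ progressive P, positive_process P, locally_bounded_above P &
      forall t w, 0 <= t -> P t w `^ (1 + beta) = X t w * f (run_sup P t w)].

End processes.

(* Main.v *)
(* Write [f] for the operator evaluated at [Psi], [h p = p^(1+beta) / f p] and
   [q] for the inverse of [h].  Since [x phi(x) = q(x)^(1+beta)], one has
   [Phi_i = Psi_i o q], whence [phi = f o q] is the operator evaluated at [Phi].

   Differences of convex functions.  A function [g], continuous on [0, +oo[, is
   a difference of convex functions iff it has a left derivative on ]0, +oo[ and
   the intercept [g(x) - x g'(x)] of its left tangent line is of finite variation
   on every ]0, T].  (As [d(g - x g') = - x dg'], this allows infinite slopes at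
   0.)  With [p = q(x)], the intercept of [Psi_i o q] at [x] is
   [Psi_i(p) - p Psi_i'(p) / E(p)], where the elasticity
   [E(p) = p h'(p) / h(p) = beta + (f(p) - p f'(p)) / f(p) >= 1 + beta] only
   involves the intercept of [f]; such an expression has finite variation
   because monotone functions generate an algebra of functions of finite
   variation, and so does its composition with the increasing map [q].

   The equation.  If [P] is a solution then, [f] being nonincreasing,
   [h(P_s) <= X_s <= h(sup_{r <= s} P_r)]; taking suprema, the running supremum
   of [P] is [q] of that of [X].  That the running supremum of a progressive
   process is progressive requires the projection of a measurable subset of
   [0, t] x Omega to be in the complete sigma-algebra [F_t]: the subset is
   obtained by the Souslin operation from rectangles with closed sides, its
   projection by the same operation from [F_t], and complete sigma-algebras are
   stable under this operation. *)
Require Import Defs.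
From mathcomp Require Import all_boot all_order all_algebra.
From mathcomp Require Import all_classical all_reals all_analysis.
From mathcomp Require Import measurable_realfun.
From mathcomp Require Import ring lra.
Import Order.TTheory GRing.Theory Num.Theory.
Import numFieldNormedType.Exports.

Set Implicit Arguments.
Unset Strict Implicit.
Unset Printing Implicit Defensive.

Local Open Scope classical_set_scope.
Local Open Scope ring_scope.

(** * The measurable projection theorem *)

Section natural_pairing.
Local Open Scope nat_scope.

(** Each positive integer is uniquely a power of 2 times an odd number. This pairing is increasing
    in [j], so the first terms of a coded subsequence are read at bounded positions. *)
Definition pair_nat (k j : nat) : nat := (2 ^ k * j.*2.+1).-1.
Definition unpair_nat (m : nat) : nat * nat :=
  (logn 2 m.+1, (m.+1 %/ 2 ^ logn 2 m.+1)./2).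

Lemma pair_natS k j : (pair_nat k j).+1 = 2 ^ k * j.*2.+1.
Proof. by rewrite /pair_nat prednK// muln_gt0 expn_gt0. Qed.

Lemma pair_natK k j : unpair_nat (pair_nat k j) = (k, j).
Proof.
rewrite /unpair_nat pair_natS lognM ?expn_gt0// pfactorK//.
have -> : logn 2 j.*2.+1 = 0.
  by rewrite logn_coprime// coprime2n/= odd_double.
by rewrite addn0 mulKn ?expn_gt0//= uphalf_double.
Qed.

Lemma unpair_natK m : pair_nat (unpair_nat m).1 (unpair_nat m).2 = m.
Proof.
apply: succn_inj; rewrite pair_natS /unpair_nat/=.
set k := logn 2 m.+1.
have dk : 2 ^ k %| m.+1 by exact: pfactor_dvdnn.
have ok : odd (m.+1 %/ 2 ^ k).
  rewrite -[odd _]negbK -dvdn2; apply/negP => /dvdnP[q qE].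
  have : 2 ^ k.+1 %| m.+1.
    by rewrite -(divnK dk) qE expnS -mulnA (mulnC q) dvdn_mulr// dvdn_mul.
  by rewrite pfactor_dvdn// -/k ltnn.
have := odd_double_half (m.+1 %/ 2 ^ k); rewrite ok add1n => ->.
by rewrite mulnC divnK.
Qed.

Lemma ltn_pair_nat k j n : j < n -> pair_nat k j < pair_nat k n.
Proof.
move=> jn; rewrite -ltnS !pair_natS ltn_pmul2l ?expn_gt0//.
by rewrite ltnS ltn_double.
Qed.

End natural_pairing.


Lemma mkseq_cons T (s : nat -> T) n :
  mkseq s n.+1 = s 0%N :: mkseq (s \o succn) n.
Proof. by rewrite /mkseq/= -[1%N]addn0 iotaDl -map_comp. Qed.

(** * The Souslin operation *)

Section souslin.
Variable T : Type.
Implicit Types (G : set (set T)) (S : set T).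

(** Here [A] is a scheme indexed by finite sequences, and [mkseq s n] is the initial segment of
    length [n] of the branch [s], the empty one included. *)
Definition souslin G S := exists2 A : seq nat -> set T, forall l, G (A l) &
  S = [set x | exists s : nat -> nat, forall n, A (mkseq s n) x].

Lemma sub_souslin G : G `<=` souslin G.
Proof.
move=> S GS; exists (fun=> S) => //; apply/seteqP; split => x /=.
  by move=> Sx; exists id.
by move=> [_ /(_ 0%N)].
Qed.

(** The first term of a branch selects the index [k], and the remaining terms form a branch for
    [S k]. At the empty sequence, where no index is chosen yet, the scheme takes the value
    [setT]. *)
Lemma souslin_bigcup G (S : nat -> set T) : G [set: T] ->
  (forall k, souslin G (S k)) -> souslin G (\bigcup_k S k).
Proof.
move=> GT SS; have /choice[A AP] : forall k, exists A : seq nat -> set T,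
    (forall l, G (A l)) /\
    S k = [set x | exists s : nat -> nat, forall n, A (mkseq s n) x].
  by move=> k; have [A ? ?] := SS k; exists A.
exists (fun l => if l is k :: l' then A k l' else setT).
  by move=> [//|k l]; exact: (AP k).1.
apply/seteqP; split => x /=.
  move=> [k _]; rewrite (AP k).2 => -[s sx].
  exists (fun n => if n is n'.+1 then s n' else k) => -[//|n].
  by rewrite mkseq_cons/=; exact: sx.
move=> [s sx]; exists (s 0%N) => //; rewrite (AP _).2.
by exists (s \o succn) => n; move: (sx n.+1); rewrite mkseq_cons.
Qed.

(* The first [n] terms of the subsequence [s \o pair_nat k] are among the first
   [pair_nat k n] terms of [s]. *)
Lemma souslin_bigcap G (S : nat -> set T) :
  (forall k, souslin G (S k)) -> souslin G (\bigcap_k S k).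
Proof.
move=> SS; have /choice[A AP] : forall k, exists A : seq nat -> set T,
    (forall l, G (A l)) /\
    S k = [set x | exists s : nat -> nat, forall n, A (mkseq s n) x].
  by move=> k; have [A ? ?] := SS k; exists A.
(* A sequence of length [pair_nat k n] undergoes the [n]-th test of [S k], applied to its entries at
   the positions [pair_nat k j]. *)
exists (fun l => let kn := unpair_nat (size l) in
   A kn.1 (mkseq (fun j => nth 0%N l (pair_nat kn.1 j)) kn.2)).
  by move=> l; exact: (AP _).1.
have E s k n : mkseq (fun j => nth 0%N (mkseq s (pair_nat k n)) (pair_nat k j)) n
    = mkseq (s \o pair_nat k) n.
  apply/eq_in_map => j; rewrite mem_iota add0n => /andP[_ jn].
  by rewrite nth_mkseq// ltn_pair_nat.
apply/seteqP; split => x.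
  move=> Sx; have /choice[s sx] : forall k, exists s : nat -> nat,
      forall n, A k (mkseq s n) x.
    by move=> k; have := Sx k I; rewrite (AP k).2.
  (* The branches are merged by placing [s k j] at position [pair_nat k j]. *)
  exists (fun m => s (unpair_nat m).1 (unpair_nat m).2) => m.
  have [k [n ->]] : exists k n, m = pair_nat k n.
    by exists (unpair_nat m).1, (unpair_nat m).2; rewrite unpair_natK.
  cbv zeta; rewrite size_mkseq pair_natK [(k, n).1]/= [(k, n).2]/= E.
  rewrite (_ : mkseq _ _ = mkseq (s k) n); first exact: sx.
  by apply: eq_mkseq => j; rewrite /comp pair_natK.
move=> [s sx] k _; rewrite (AP k).2; exists (s \o pair_nat k) => n.
by move: (sx (pair_nat k n)); rewrite size_mkseq pair_natK/= E.
Qed.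

(** Stability under countable unions and intersections makes the Souslin sets with Souslin
    complement a sigma-algebra; by hypothesis it contains [G]. *)
Lemma souslin_sigma_algebra G : G [set: T] ->
  (forall A, G A -> souslin G (~` A)) -> <<s G >> `<=` souslin G.
Proof.
move=> GT GC.
suff : <<s G >> `<=` [set S | souslin G S /\ souslin G (~` S)].
  by move=> sub S /sub[].
apply: smallest_sub; last first.
  by move=> A GA; split; [exact: sub_souslin|exact: GC].
split => [|A [sA sCA]|A sA] /=.
- by rewrite setC0; split; [rewrite -setCT; exact: GC|exact: sub_souslin].
- by rewrite setTD setCK.
- split; first by apply: souslin_bigcup => // k; exact: (sA k).1.
  by rewrite setC_bigcup; apply: souslin_bigcap => k; exact: (sA k).2.
Qed.

(* König's lemma. *)
Lemma bounded_branch (A : seq nat -> Prop) (b : nat -> nat) :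
  (forall n, exists2 s : nat -> nat, forall j, (s j <= b j)%N &
    forall m, (m < n)%N -> A (mkseq s m)) ->
  exists s : nat -> nat, forall m, A (mkseq s m).
Proof.
move=> bA.
(* [Q l]: to every depth, [l] continues to a bounded sequence passing the tests below that depth.
   The branch is built by extending [l] while keeping [Q]. *)
pose Q (l : seq nat) := forall n, exists2 s : nat -> nat,
  (forall j, (s j <= b j)%N) /\ mkseq s (size l) = l &
  forall m, (m < n)%N -> A (mkseq s m).
have Qstep l : exists k, Q l -> Q (rcons l k).
  apply: contrapT => /forallNP nQ.
  have [Ql _] := (not_implyP _ _).1 (nQ 0%N).
  have /choice[N NP] : forall k, exists n, ~ exists2 s : nat -> nat,
    (forall j, (s j <= b j)%N) /\ mkseq s (size l).+1 = rcons l k &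
    forall m, (m < n)%N -> A (mkseq s m).
    move=> k; have [_ /existsNP[n]] := (not_implyP _ _).1 (nQ k).
    by rewrite size_rcons; exists n.
  (* [N k] is a depth at which the extension by [k] fails. Only values up to [b (size l)] can follow
     [l], so the maximum of finitely many [N k] is a depth that refutes [Q l]. *)
  have [s [sb sl] sA] := Ql (\max_(k < (b (size l)).+1) N k)%N.
  apply: (NP (s (size l))); exists s.
    by split=> //; rewrite mkseqS sl.
  move=> m mN; apply: sA; apply: (leq_trans mN).
  have sl' : (s (size l) < (b (size l)).+1)%N by rewrite ltnS.
  exact: (leq_bigmax (F := fun k : 'I_ _ => N k) (Ordinal sl')).
have /choice[k kP] := Qstep.
pose L := fix L n := if n is n'.+1 then rcons (L n') (k (L n')) else [::].
have QL n : Q (L n).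
  elim: n => [|n IH]; last exact: kP.
  by move=> n; have [s ? ?] := bA n; exists s.
exists (fun n => k (L n)) => m.
have -> : mkseq (fun n => k (L n)) m = L m.
  by elim: m => // m IH; rewrite mkseqS/= IH.
have sL : size (L m) = m by elim: m => //= m IH; rewrite size_rcons IH.
have [s [_ sl] sA] := QL m m.+1.
by have := sA m (ltnSn m); rewrite -{1}sL sl.
Qed.

End souslin.

(** * The Souslin operation over a complete sigma-algebra *)

Section souslin_complete.
Context d (Omega : measurableType d) (R : realType) (Pr : probability Omega R).
Variable G : set (set Omega).
Hypotheses (sG : sigma_algebra [set: Omega] G) (Gm : G `<=` measurable).
Hypothesis Gneg : Pr.-negligible `<=` G.
Local Open Scope ereal_scope.

Let measurable_gE : (@measurable _ (g_sigma_algebraType G)) = G :> set (set Omega).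
Proof. exact: sigma_algebra_id. Qed.

Let Gbigcup (S : (set Omega)^nat) : (forall n, G (S n)) -> G (\bigcup_n S n).
Proof. by rewrite -measurable_gE; exact: bigcupT_measurable. Qed.

Let Gbigcap (S : (set Omega)^nat) : (forall n, G (S n)) -> G (\bigcap_n S n).
Proof.
rewrite -measurable_gE => mS.
exact: (@bigcapT_measurable _ (g_sigma_algebraType G)).
Qed.

(* That is, the outer measure of [S] relative to [G], an infimum that is
   attained, exceeds [r]. *)
Let outer_gt (r : \bar R) (S : set Omega) :=
  forall B, G B -> S `<=` B -> r < Pr B.

(** Otherwise each [S n] has a cover [B n] of measure at most [r]. The intersections [C n] of the
    tails of [B] still cover [S n] and increase with [n], so their union has measure at most [r]. *)
Let outer_gt_bigcup r (S : (set Omega)^nat) : nondecreasing_seq S ->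
  outer_gt r (\bigcup_n S n) -> exists n, outer_gt r (S n).
Proof.
move=> ndS Sr; apply: contrapT => /forallNP nS.
have /choice[B BP] : forall n, exists B, [/\ G B, S n `<=` B & Pr B <= r].
  move=> n; move/existsNP : (nS n) => [B].
  move=> /not_implyP[GB /not_implyP[SB /negP]]; rewrite -leNgt => rB.
  by exists B.
pose C n := \bigcap_m B (n + m)%N.
have GC n : G (C n) by apply: Gbigcap => m; have [] := BP (n + m)%N.
have SC n : S n `<=` C n.
  move=> x Sx m _; have [_ SB _] := BP (n + m)%N; apply: SB.
  by move: x Sx; apply/subsetPset/ndS; rewrite leq_addr.
have ndC : nondecreasing_seq C.
  move=> n m nm; apply/subsetPset => x Cx k _.
  by rewrite -(subnKC nm) -addnA; exact: Cx.
have := Sr (\bigcup_n C n) (Gbigcup GC) (subset_bigcup (fun n _ => SC n)).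
apply/negP; rewrite -leNgt.
have cC : Pr \o C @ \oo --> Pr (\bigcup_n C n).
  by apply: nondecreasing_cvg_mu => // *; apply: Gm => //; exact: Gbigcup.
rewrite -(cvg_lim _ cC)//; apply: lime_le; first by apply/cvg_ex; eexists; exact: cC.
apply: nearW => n /=; have [GB _] := BP n; apply: le_trans.
apply: le_measure; rewrite ?inE; [exact: Gm|exact: Gm|].
by move=> x /(_ 0%N I); rewrite addn0.
Qed.

(** A capacitability argument. Bounds [b j] are chosen one by one so that the points having a branch
    bounded by [b] in its first [n] terms keep outer measure above [r]. The sets [K n] of [G]
    contain these points, decrease, and by König's lemma intersect inside [S]. *)
Let souslin_inner r (S : set Omega) : souslin G S -> outer_gt r S ->
  exists B, [/\ G B, B `<=` S & r <= Pr B].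
Proof.
move=> [A GA ->] Ar.
pose E (l : seq nat) := [set x | exists2 s : nat -> nat,
  (forall j, (j < size l)%N -> (s j <= nth 0%N l j)%N) &
  forall n, A (mkseq s n) x].
have Estep l : exists k, outer_gt r (E l) -> outer_gt r (E (rcons l k)).
  have [El|] := pselect (outer_gt r (E l)); last by exists 0%N.
  suff : exists k, outer_gt r (E (rcons l k)) by move=> [k]; exists k.
  apply: outer_gt_bigcup.
    move=> m n mn; apply/subsetPset => x [s sl sx]; exists s => // j jl.
    apply: leq_trans (sl j _) _; first by move: jl; rewrite !size_rcons.
    by rewrite !nth_rcons; case: ifP => //; case: ifP.
  move=> B GB EB; apply: El => // x [s sl sx]; apply: EB.
  exists (s (size l)) => //; exists s => // j.
  rewrite size_rcons nth_rcons ltnS leq_eqVlt => /predU1P[->|jl].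
    by rewrite ltnn eqxx.
  by rewrite jl; exact: sl.
have /choice[k kP] := Estep.
pose L := fix L n := if n is n'.+1 then rcons (L n') (k (L n')) else [::].
pose b n := k (L n).
have Lb n : L n = mkseq b n by elim: n => // n IH; rewrite mkseqS -IH.
have Er n : outer_gt r (E (mkseq b n)).
  rewrite -Lb; elim: n => [|n IH]; last exact: kP.
  move=> B GB EB; apply: Ar => // x [s sx]; apply: EB; exists s => //.
pose K n := [set x | exists2 s : nat -> nat, (forall j, (s j <= b j)%N) &
  forall m, (m < n)%N -> A (mkseq s m) x].
have EK n : E (mkseq b n) `<=` K n.
  (* Terms of index [n] or more are reset to 0 so that [b] bounds them; the tests below depth [n] do
     not read them. *)
  move=> x [s sb sx]; exists (fun j => if (j < n)%N then s j else 0%N).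
    move=> j; case: ifP => // jn.
    by have := sb j; rewrite size_mkseq nth_mkseq//; exact.
  move=> m mn; rewrite (_ : mkseq _ m = mkseq s m)//.
  apply/eq_in_map => j; rewrite mem_iota add0n => /andP[_ jm].
  by rewrite (ltn_trans jm mn).
have GK n : G (K n).
  (* Membership in [K n] depends on finitely many terms, which turns the union over branches into a
     countable one over finite sequences. *)
  have -> : K n = \bigcup_(l : seq nat) (if all (fun j => nth 0%N l j <= b j)%N (iota 0 n)
      then \bigcap_(m in `I_n) A (mkseq (nth 0%N l) m) else set0).
    apply/seteqP; split => x.
      move=> [s sb sx]; exists (mkseq s n) => //.
      have E1 j : (j < n)%N -> nth 0%N (mkseq s n) j = s j by move/(nth_mkseq 0%N s).
      have -> : all (fun j => nth 0%N (mkseq s n) j <= b j)%N (iota 0 n).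
        by apply/allP => j; rewrite mem_iota add0n => /andP[_ /E1->].
      move=> m /= mn; rewrite (_ : mkseq _ m = mkseq s m); first exact: sx.
      apply/eq_in_map => j; rewrite mem_iota add0n => /andP[_ jm].
      by rewrite E1// (ltn_trans jm mn).
    move=> [l _]; case: ifPn => // /allP lb lx.
    exists (fun j => if (j < n)%N then nth 0%N l j else 0%N).
      by move=> j; case: ifP => // jn; apply: lb; rewrite mem_iota.
    move=> m mn; rewrite (_ : mkseq _ m = mkseq (nth 0%N l) m); first exact: lx.
    apply/eq_in_map => j; rewrite mem_iota add0n => /andP[_ jm].
    by rewrite (ltn_trans jm mn).
  rewrite -measurable_gE.
  apply: (@countable_bigcupT_measurable _ (g_sigma_algebraType G)); first exact: countableP.
  move=> l; case: ifP => // _.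
  apply: (@fin_bigcap_measurable _ (g_sigma_algebraType G)) => //.
  by move=> m _; rewrite measurable_gE; exact: GA.
exists (\bigcap_n K n); split; first exact: Gbigcap.
  move=> x Kx; have [s sx] := @bounded_branch (fun l => A l x) b (fun n => Kx n I).
  by exists s.
have cK : Pr \o K @ \oo --> Pr (\bigcap_n K n).
  apply: nonincreasing_cvg_mu => //.
  - by rewrite (le_lt_trans (probability_le1 _ _)) ?ltry//; exact: Gm.
  - by move=> n; exact: Gm.
  - by apply: Gm; exact: Gbigcap.
  - move=> n m nm; apply/subsetPset => x [s sb sx]; exists s => // i ni.
    by apply: sx; exact: leq_trans nm.
rewrite -(cvg_lim _ cK)//; apply: lime_ge; first by apply/cvg_ex; eexists; exact: cK.
by apply: nearW => n /=; apply/ltW/(Er n) => //; exact: EK.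
Qed.

(** Let [s] be the supremum of the measures of subsets of [S] in [G]. It is attained by a union of
    the [B n], and an intersection of covers [C n] has measure at most [s]; [S] differs from the
    inner set by a negligible set. *)
Lemma souslin_complete : souslin G `<=` G.
Proof.
move=> S sS.
pose V := [set Pr B | B in [set B | G B /\ B `<=` S]].
pose s := ereal_sup V.
have [u uV us] : {u : nat -> \bar R | forall i, V (u i) & u @ \oo --> s}.
  apply: ereal_sup_seq; apply/set0P; exists (Pr set0), set0 => //; split => //.
  by case: sG.
have /choice[B BP] : forall n, exists B, [/\ G B, B `<=` S & Pr B = u n].
  by move=> n; have [B [GB BS] BE] := uV n; exists B.
have GB : G (\bigcup_n B n) by apply: Gbigcup => n; have [] := BP n.
have BS : \bigcup_n B n `<=` S by move=> x [n _]; have [_ BS _] := BP n; exact: BS.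
have sB : s <= Pr (\bigcup_n B n).
  rewrite -(cvg_lim _ us)//; apply: lime_le; first by apply/cvg_ex; eexists; exact: us.
  apply: nearW => n; have [GBn _ <-] := BP n.
  by apply: le_measure; rewrite ?inE; [exact: Gm|exact: Gm|exact: bigcup_sup].
have s0 : 0 <= s.
  have [B0 VB0 _] := uV 0%N.
  by apply: le_trans (measure_ge0 Pr B0) (ereal_sup_ubound _) => //; exists B0.
have sfin : s \is a fin_num.
  rewrite ge0_fin_numE// (le_lt_trans sB)//.
  by rewrite (le_lt_trans (probability_le1 _ _)) ?ltry//; exact: Gm.
(* Without such a cover, [souslin_inner] would give a subset of [S] in [G] of measure above [s]. *)
have /choice[C CP] : forall n, exists C, [/\ G C, S `<=` C &
    Pr C <= s + (n.+1%:R^-1)%:E].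
  move=> n; apply: contrapT => nC.
  have /(souslin_inner sS)[D [GD DS]] : outer_gt (s + (n.+1%:R^-1)%:E) S.
    move=> D GD SD; rewrite ltNge; apply/negP => DE; apply: nC.
    by exists D.
  apply/negP; rewrite -ltNge (@le_lt_trans _ _ s)//.
    by apply: ereal_sup_ubound; exists D.
  by rewrite lteDl// lte_fin invr_gt0.
have GC : G (\bigcap_n C n) by apply: Gbigcap => n; have [] := CP n.
have SC : S `<=` \bigcap_n C n by move=> x Sx n _; have [_ SC _] := CP n; exact: SC.
have Cs : Pr (\bigcap_n C n) <= s.
  apply/lee_addgt0Pr => e e0.
  have [n ne] : exists n, (n.+1%:R^-1 < e)%R.
    have [n _ ne] := near_infty_natSinv_lt (PosNum e0).
    by exists n; exact: (ne n (leqnn n)).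
  have [GCn _ Cn] := CP n.
  apply: (@le_trans _ _ (Pr (C n))).
    by apply: le_measure; rewrite ?inE; [exact: Gm|exact: Gm|exact: bigcap_inf].
  by apply: le_trans Cn _; rewrite leeD2l// lee_fin ltW.
rewrite -(setDUK BS) -measurable_gE.
apply: (@measurableU _ (g_sigma_algebraType G)); rewrite measurable_gE//.
apply: Gneg; exists (\bigcap_n C n `\` \bigcup_n B n); split.
- by apply: measurableD; exact: Gm.
- rewrite measureD; [|exact: Gm|exact: Gm|].
    rewrite setIidr//; last exact: subset_trans SC.
    apply/eqP; rewrite eq_le; apply/andP; split; first by rewrite sube_le0 (le_trans Cs).
    rewrite sube_ge0; last by rewrite fin_num_measure//; exact: Gm.
    by apply: le_measure; rewrite ?inE; [exact: Gm|exact: Gm|exact: subset_trans SC].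
  by rewrite (le_lt_trans (probability_le1 _ _)) ?ltry//; exact: Gm.
- exact: setSD.
Qed.

End souslin_complete.

(** * Projection of measurable sets along a compact interval *)

Lemma setCitvcy_bigcup (R : realType) (x : R) :
  ~` `[x, +oo[%classic = \bigcup_n `]-oo, x - n.+1%:R^-1]%classic.
Proof.
rewrite setCitvr; apply/seteqP; split => y; rewrite /= in_itv/=.
  rewrite -subr_gt0 => xy.
  have [n _ ne] := near_infty_natSinv_lt (PosNum xy).
  exists n => //=; rewrite in_itv/=.
  by rewrite lerBrDr -lerBrDl; exact/ltW/(ne n (leqnn n)).
by move=> [n _]; rewrite /= in_itv/= => /le_lt_trans; apply; rewrite ltrBlDr ltrDl invr_gt0.
Qed.

(** Points witnessing the finite intersections form a sequence in [C]; any of its cluster points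
    lies in every [K m]. *)
Lemma compact_nested_closed (T : topologicalType) (C : set T) (K : (set T)^nat) :
  compact C -> (forall n, closed (K n)) ->
  (forall n, (C `&` \bigcap_(m in `I_n.+1) K m) !=set0) ->
  (C `&` \bigcap_n K n) !=set0.
Proof.
move=> cC clK /choice[u uP].
have uC : (u @ \oo) C by exists 0%N => // n _; exact: (uP n).1.
have [p [Cp clp]] := cC (u @ \oo) _ uC.
exists p; split => // m _.
move: clp; rewrite clusterE => /(_ (K m)); rewrite -(closure_id (K m)).1//; apply.
by exists m => // n /= mn; apply: (uP n).2 => /=; rewrite ltnS.
Qed.

Section measurable_projection.
Context d (Omega : measurableType d) (R : realType) (Pr : probability Omega R).
Variable G : set (set Omega).
Hypotheses (sG : sigma_algebra [set: Omega] G) (Gm : G `<=` measurable).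
Hypothesis Gneg : Pr.-negligible `<=` G.

Let measurable_gE : (@measurable _ (g_sigma_algebraType G)) = G :> set (set Omega).
Proof. exact: sigma_algebra_id. Qed.

Let GT : G setT.
Proof. by rewrite -measurable_gE; exact: measurableT. Qed.

(** These sets generate the Borel sets, are closed, and have complements that are countable unions
    of sets of the same kind; the last property feeds [souslin_sigma_algebra]. *)
Let halfline (K : set R) := [\/ K = setT, K = set0,
  exists x, K = `[x, +oo[%classic | exists x, K = `]-oo, x]%classic].

Let rectangle := [set K `*` B | K in halfline & B in G].

Let measurable_rectangle :
  @measurable _ (R * g_sigma_algebraType G)%type `<=` <<s rectangle >>.
Proof.
rewrite measurable_prod_measurableType; apply: smallest_sub.
  exact: smallest_sigma_algebra.
move=> _ [A mA] [B mB] <-.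
have mfst : @measurable _ (g_sigma_algebraType rectangle) (fst @^-1` A).
  rewrite -[_ @^-1` _]setTI.
  suff mf : measurable_fun [set: g_sigma_algebraType rectangle]
    (fst : g_sigma_algebraType rectangle -> R) by exact: mf.
  apply: (measurability (@RGenCInfty.G R)) => [|_ [_ [x ->] <-]].
    exact: RGenCInfty.measurableE.
  rewrite setTI; apply: sub_sigma_algebra; exists `[x, +oo[%classic.
    by constructor 3; exists x.
  by exists setT => //; apply/seteqP; split => [[r w] []|[r w]].
have mB' : @measurable _ (g_sigma_algebraType rectangle) (setT `*` B).
  apply: sub_sigma_algebra; exists setT; first by constructor 1.
  by exists B => //; rewrite -measurable_gE.
have -> : A `*` B = (fst @^-1` A) `&` (setT `*` B).
  by apply/seteqP; split => [[r w] [? ?]|[r w] [? []]].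
exact: (@measurableI _ (g_sigma_algebraType rectangle)).
Qed.

Let halflineC K : halfline K -> exists2 L : (set R)^nat,
  (forall n, halfline (L n)) & ~` K = \bigcup_n L n.
Proof.
case => [->|->|[x ->]|[x ->]].
- exists (fun=> set0); first by move=> _; constructor 2.
  by rewrite setCT bigcup0.
- exists (fun=> setT); first by move=> _; constructor 1.
  by rewrite setC0; apply/seteqP; split => // x _; exists 0%N.
- exists (fun n => `]-oo, x - n.+1%:R^-1]%classic).
    by move=> n; constructor 4; eexists.
  exact: setCitvcy_bigcup.
- exists (fun n => `[x + n.+1%:R^-1, +oo[%classic).
    by move=> n; constructor 3; eexists.
  by rewrite setCitvl itvoyEbigcup.
Qed.

Let closed_halfline K : halfline K -> closed K.
Proof. by case=> [->|->|[x ->]|[x ->]];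
  [exact: closedT|exact: closed0|exact: interval_closed|exact: interval_closed]. Qed.

Let souslin_measurable :
  @measurable _ (R * g_sigma_algebraType G)%type `<=` souslin rectangle.
Proof.
have rT : rectangle setT.
  exists setT; first by constructor 1.
  by exists setT => //; rewrite setXTT.
apply: subset_trans measurable_rectangle _.
apply: souslin_sigma_algebra => // _ [K hK] [B GB] <-.
have [L hL KL] := halflineC hK.
pose D n := if n is n'.+1 then L n' `*` setT else setT `*` ~` B.
have -> : ~` (K `*` B) = \bigcup_n D n.
  apply/seteqP; split => [[s w] /= /not_andP[Ks|Bw]|[s w]].
  - have : (~` K) s by [].
    by rewrite KL => -[n _ Ln]; exists n.+1.
  - by exists 0%N.
  - move=> [[|n] _ [/= + +]]; first by move=> _ + [].
    move=> Ln _ [Ks _]; have : (\bigcup_n L n) s by exists n.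
    by rewrite -KL.
apply: souslin_bigcup => // -[|n]; apply: sub_souslin.
  exists setT; first by constructor 1.
  by exists (~` B) => //; rewrite -setTD; case: sG => _ + _; exact.
by exists (L n) => //; exists setT.
Qed.

(** Along a fixed branch, compactness of the interval yields a common time [s] as soon as every
    finite intersection of closed sides meets the interval. The projection is thus a Souslin set
    over [G]. *)
Lemma measurable_proj (E : set (R * g_sigma_algebraType G)) (a b : R) :
  measurable E -> G [set w | exists2 s, s \in `[a, b] & E (s, w)].
Proof.
move=> /souslin_measurable[A GA ->].
have /choice[KB KBP] : forall l, exists KB : set R * set Omega,
    [/\ closed KB.1, G KB.2 & A l = KB.1 `*` KB.2].
  move=> l; have [K hK [B GB <-]] := GA l.
  by exists (K, B); split => //=; exact: closed_halfline.
(* The test at [l] covers all prefixes of [l], itself included: their closed sides must meet jointly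
   in the interval, and [w] must lie in all their other sides. *)
pose B' l := if `[< (`[a, b] `&` \bigcap_(m in `I_(size l).+1) (KB (take m l)).1) !=set0 >]
  then \bigcap_(m in `I_(size l).+1) (KB (take m l)).2 else set0.
have take_mkseq (s : nat -> nat) n m : (m < n.+1)%N ->
    take m (mkseq s n) = mkseq s m.
  by rewrite ltnS => mn; rewrite /mkseq -map_take take_iota (minn_idPl mn).
apply: (souslin_complete sG Gm Gneg); exists B'.
  move=> l; rewrite /B'; case: ifP => _; last by case: sG.
  rewrite -measurable_gE.
  apply: (@fin_bigcap_measurable _ (g_sigma_algebraType G)) => //.
  by move=> m _; rewrite measurable_gE; have [] := KBP (take m l).
apply/seteqP; split => w.
  move=> [s sab [f fP]]; exists f => n; rewrite /B' asboolT.
    move=> m; rewrite size_mkseq/= => mn; rewrite take_mkseq//.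
    by have := fP m; have [_ _ ->] := KBP (mkseq f m) => -[].
  exists s; split => // m; rewrite size_mkseq/= => mn; rewrite take_mkseq//.
  by have := fP m; have [_ _ ->] := KBP (mkseq f m) => -[].
move=> [f fP].
have fP1 n : (`[a, b] `&` \bigcap_(m in `I_n.+1) (KB (mkseq f m)).1) !=set0.
  have := fP n; rewrite /B'; case: asboolP => // -[s []] sab sK _.
  exists s; split => // m /= mn; rewrite -(take_mkseq f n m)//.
  by apply: sK; rewrite /= size_mkseq.
have [s [sab sK]] : (`[a, b] `&` \bigcap_n (KB (mkseq f n)).1) !=set0.
  apply: compact_nested_closed => //; first exact: segment_compact.
  by move=> n; have [] := KBP (mkseq f n).
exists s => //; exists f => n; have [_ _ ->] := KBP (mkseq f n); split => /=.
  exact: sK.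
have := fP n; rewrite /B'; case: asboolP => // _ /(_ n).
by rewrite size_mkseq take_mkseq//; apply => /=.
Qed.

End measurable_projection.

(** * Running suprema of progressive processes *)

Section running_supremum.
Context d (Omega : measurableType d) (R : realType).
Implicit Types (X Y : R -> Omega -> R).

Lemma eq_run_sup X Y t w : (forall s, 0 <= s <= t -> X s w = Y s w) ->
  run_sup X t w = run_sup Y t w.
Proof.
move=> XY.
have E : [set X s w | s in `[0, t]] = [set Y s w | s in `[0, t]].
  by apply: eq_imagel => s; rewrite /= in_itv/=; exact: XY.
by rewrite /run_sup E.
Qed.

Lemma run_sup_gt X t w a : 0 <= t -> has_ubound [set X s w | s in `[0, t]] ->
  (a < run_sup X t w) <-> exists2 s, 0 <= s <= t & a < X s w.
Proof.
move=> t0 ubX; split => [/sup_gt[]|[s st aX]].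
- by exists (X 0 w), 0 => //; rewrite /= in_itv/= lexx.
- by move=> _ [s st <-] aX; exists s => //; move: st; rewrite /= in_itv.
- by apply: lt_le_trans aX _; apply: ub_le_sup => //; exists s => //=; rewrite in_itv.
Qed.

Lemma run_sup_le X t w a : 0 <= t -> has_ubound [set X s w | s in `[0, t]] ->
  (run_sup X t w <= a) <-> forall s, 0 <= s <= t -> X s w <= a.
Proof.
move=> t0 ubX; split => [Xa s st|Xa]; rewrite leNgt; apply/negP.
  move=> aX; move: Xa; rewrite leNgt => /negP; apply.
  by apply/run_sup_gt => //; exists s.
by move=> /run_sup_gt-/(_ t0 ubX)[s /Xa]; rewrite ltNge => ->.
Qed.

Lemma run_sup_ge X t w s : has_ubound [set X s w | s in `[0, t]] ->
  0 <= s <= t -> X s w <= run_sup X t w.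
Proof. by move=> ubX st; apply: ub_le_sup => //; exists s => //=; rewrite in_itv. Qed.

Lemma le_run_sup X w s t : has_ubound [set X s w | s in `[0, t]] ->
  0 <= s -> s <= t -> run_sup X s w <= run_sup X t w.
Proof.
move=> ubX s0 st; apply: sup_le_ub.
  by exists (X 0 w), 0 => //; rewrite /= in_itv/= lexx.
move=> y [r + <-]; rewrite /= in_itv/= => /andP[r0 rs].
by apply: run_sup_ge => //; rewrite r0 (le_trans rs).
Qed.

Lemma progressive_run_sup (Pr : probability Omega R) (F : R -> set (set Omega)) X :
  filtration F -> complete_filtration Pr F ->
  locally_bounded_above X -> progressive F X -> progressive F (run_sup X).
Proof.
move=> [sF Fm _] cF ubX pX t t0.
set D := _ `*` _.
have mD : measurable D by apply: measurableX => //; exact: measurable_itv.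
apply: (measurability (@RGenOInfty.G R)) => [|_ [_ [a ->] <-]].
  exact: RGenOInfty.measurableE.
pose E := D `&` (fun sw => X sw.1 sw.2) @^-1` `]a, +oo[%classic.
have mE : measurable E by apply: pX => //; exact: measurable_itv.
(* A time [r <= s] at which [X] exceeds [a] is either [s] itself, which is the set [E], or separated
   from [s] by a rational [q]. For fixed [q], the outcomes form the projection of a measurable
   set. *)
pose H (q : rat) := (`]ratr q, +oo[%classic : set R) `*`
  ([set w | exists2 s, s \in `[0, ratr q] & E (s, w)] : set (g_sigma_algebraType (F t))).
have -> : D `&` (fun sw => run_sup X sw.1 sw.2) @^-1` `]a, +oo[%classic =
    E `|` (D `&` \bigcup_q H q).
  apply/seteqP; split => [[s w] [[+ _]]|[s w]].
    rewrite /= !in_itv/= andbT => /andP[s0 st].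
    move=> /run_sup_gt-/(_ s0 (ubX s w s0))[r /andP[r0]].
    rewrite le_eqVlt => /predU1P[->|rs] aX.
      by left; do 2?split => //=; rewrite in_itv/= ?s0 ?andbT.
    right; split; first by split => //=; rewrite in_itv/= s0.
    have [q] := rat_in_itvoo rs; rewrite in_itv/= => /andP[rq qs].
    exists q => //; split => /=; first by rewrite in_itv/= qs.
    exists r; first by rewrite in_itv/= r0 ltW.
    by do 2?split => //=; rewrite in_itv/= ?andbT ?r0// (le_trans (ltW rs)).
  move=> [[Dsw]|[Dsw [q _ [/=]]]].
    move: (Dsw) => [+ _]; rewrite /= !in_itv/= !andbT => /andP[s0 st] aX.
    split => //; apply/run_sup_gt => //; first exact: ubX.
    by exists s => //; rewrite s0 lexx.
  rewrite in_itv/= andbT => qs [r]; rewrite in_itv/= => /andP[r0 rq] [_ /=].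
  rewrite in_itv/= andbT => aX.
  move: (Dsw) => [+ _]; rewrite /= !in_itv/= => /andP[s0 st].
  split => //; rewrite ?andbT; apply/run_sup_gt => //; first exact: ubX.
  by exists r => //; rewrite r0 (le_trans rq) ?ltW.
apply: measurableU => //; apply: measurableI => //.
apply: bigcupT_measurable_rat => q; apply: measurableX; first exact: measurable_itv.
apply: sub_sigma_algebra; apply: (measurable_proj (sF t t0) (Fm t t0)) => //.
exact: cF.
Qed.

End running_supremum.

(** * Differences of convex functions on the half-line *)

Section left_derivatives.
Variable R : realType.
Implicit Types (f g q : R -> R) (x l : R).

Lemma cvg_left_near_eq f g x l : (\forall y \near x^'-, f y = g y) ->
  f y @[y --> x^'-] --> l -> g y @[y --> x^'-] --> l.
Proof. by move=> fg; apply: cvg_trans; exact: near_eq_cvg. Qed.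

Lemma cvg_left_eq f g x l : (forall y, y < x -> f y = g y) ->
  f y @[y --> x^'-] --> l -> g y @[y --> x^'-] --> l.
Proof.
move=> fg; apply: cvg_left_near_eq; near=> y; apply: fg.
by near: y; exact: nbhs_left_lt.
Unshelve. all: by end_near. Qed.

Lemma near_eq_left_derivative f g x l : f x = g x ->
  {near x^'-, f =1 g} -> has_left_derivative f x l -> has_left_derivative g x l.
Proof.
move=> fgx fg; apply: cvg_trans; apply: near_eq_cvg.
by near=> y; rewrite fgx (near fg y).
Unshelve. all: by end_near. Qed.

Lemma left_derivative_cst (c x : R) : has_left_derivative (fun=> c) x 0.
Proof.
rewrite /has_left_derivative; under eq_fun do rewrite subrr mul0r.
exact: cvg_cst.
Qed.

Lemma left_derivativeD f g x l l' : has_left_derivative f x l ->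
  has_left_derivative g x l' -> has_left_derivative (fun y => f y + g y) x (l + l').
Proof.
move=> hf hg; rewrite /has_left_derivative; apply: (cvg_left_eq _ (cvgD hf hg)) => y _.
by rewrite ?fctE -mulrDl opprD addrACA.
Qed.

Lemma left_derivativeN f x l : has_left_derivative f x l ->
  has_left_derivative (fun y => - f y) x (- l).
Proof.
move=> hf; rewrite /has_left_derivative; apply: (cvg_left_eq _ (cvgN hf)) => y _.
by rewrite ?fctE -mulNr opprD.
Qed.

Lemma left_derivativeB f g x l l' : has_left_derivative f x l ->
  has_left_derivative g x l' -> has_left_derivative (fun y => f y - g y) x (l - l').
Proof. by move=> hf hg; apply: left_derivativeD => //; exact: left_derivativeN. Qed.

Lemma cvg_left_id x : y @[y --> x^'-] --> x.
Proof. exact: cvg_within. Qed.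

Lemma left_derivative_cvg f x l : has_left_derivative f x l ->
  f y @[y --> x^'-] --> f x.
Proof.
move=> hf.
have h0 : y - x @[y --> x^'-] --> x - x.
  by apply: cvgB; [exact: cvg_left_id|exact: cvg_cst].
rewrite -[X in _ --> X]add0r -[X in _ --> X + _](mulr0 l) -(subrr x).
apply: (cvg_left_eq _ (cvgD (cvgM hf h0) (cvg_cst (f x)))) => y yx.
by rewrite ?fctE/= divfK ?subrK// subr_eq0 lt_eqF.
Qed.

Lemma left_derivativeM f g x l l' : has_left_derivative f x l ->
  has_left_derivative g x l' ->
  has_left_derivative (fun y => f y * g y) x (l * g x + f x * l').
Proof.
move=> hf hg; rewrite [X in _ X]addrC.
rewrite /has_left_derivative; apply: (cvg_left_eq _
  (cvgD (cvgM (left_derivative_cvg hf) hg) (cvgM hf (cvg_cst (g x))))) => y _; rewrite ?fctE/=; ring.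
Qed.

Lemma left_derivative_is_derive f x l :
  is_derive x 1 f l -> has_left_derivative f x l.
Proof.
move=> /is_derive1_caratheodory[s [sE cs <-]].
have : s y @[y --> x^'-] --> s x by apply: cvg_at_left_filter; exact: cs.
by move=> sx; apply: (cvg_left_eq _ sx) => y yx; rewrite sE mulfK// subr_eq0 lt_eqF.
Qed.

Lemma left_derivative_comp_derive f (F : R -> R) x l L :
  is_derive (f x) 1 F L -> has_left_derivative f x l ->
  has_left_derivative (fun y => F (f y)) x (L * l).
Proof.
move=> /is_derive1_caratheodory[s [sE cs <-]] hf.
have sf : s (f y) @[y --> x^'-] --> s (f x).
  by apply: continuous_cvg; [exact: cs|exact: left_derivative_cvg hf].
rewrite /has_left_derivative; apply: (cvg_left_eq _ (cvgM sf hf)) => y _.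
by rewrite ?fctE sE mulrA.
Qed.

Lemma left_derivativeV f x l : f x != 0 -> has_left_derivative f x l ->
  has_left_derivative (fun y => (f y)^-1) x (- l / f x ^+ 2).
Proof.
move=> fx0 hf.
have -> : - l / f x ^+ 2 = - (f x) ^- 2 *: 1 * l.
  by rewrite /GRing.scale/= mulr1 mulNr mulNr mulrC.
by apply: left_derivative_comp_derive hf; exact: is_deriveV.
Qed.

Lemma left_derivative_id x : has_left_derivative id x 1.
Proof. by apply: left_derivative_is_derive; exact: is_derive_id. Qed.

Lemma left_derivative_powR x p : 0 < x ->
  has_left_derivative (fun y => y `^ p) x (p * x `^ (p - 1)).
Proof.
move=> x0; apply: left_derivative_is_derive.
have x0' : x \in `]0, +oo[ by rewrite in_itv/= x0.
apply: DeriveDef; first exact: derivable_powR.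
by rewrite -derive1E powR_derive1.
Qed.

Lemma cvg_at_left_incr q x : (\forall y \near x^'-, q y < q x) ->
  q y @[y --> x^'-] --> q x -> q y @[y --> x^'-] --> (q x)^'-.
Proof.
move=> qlt qx A /qx qA.
suff : \forall y \near x^'-, A (q y) by [].
near=> y; have : q y < q x by near: y; exact: qlt.
by near: y; exact: qA.
Unshelve. all: by end_near. Qed.

(** Since [q y < q x] for [y] near [x] on the left, the difference quotient of [f] is evaluated only
    to the left of [q x] and never at [q x]. *)
Lemma left_derivative_comp_incr f q x l L :
  (\forall y \near x^'-, q y < q x) ->
  has_left_derivative f (q x) L -> has_left_derivative q x l ->
  has_left_derivative (fun y => f (q y)) x (L * l).
Proof.
move=> qlt hf hq.
have qx := cvg_at_left_incr qlt (left_derivative_cvg hq).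
rewrite /has_left_derivative; apply: (cvg_left_near_eq _
  (cvgM (@cvg_comp _ _ _ q (fun z => (f z - f (q x)) / (z - q x)) _ _ _ qx hf) hq)).
near=> y; rewrite ?fctE/= mulrA divfK// subr_eq0 lt_eqF//.
by near: y; exact: qlt.
Unshelve. all: by end_near. Qed.

Lemma left_derivative_inverse f q x L : L != 0 ->
  (\forall y \near x^'-, q y < q x) -> q y @[y --> x^'-] --> q x ->
  (\forall y \near x^'-, f (q y) = y) -> f (q x) = x ->
  has_left_derivative f (q x) L -> has_left_derivative q x L^-1.
Proof.
move=> L0 qlt qx fq fqx hf.
have qx' := cvg_at_left_incr qlt qx.
rewrite /has_left_derivative; apply: (cvg_left_near_eq _
  (cvgV L0 (@cvg_comp _ _ _ q (fun z => (f z - f (q x)) / (z - q x)) _ _ _ qx' hf))).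
near=> y; rewrite ?fctE/= fqx (_ : f (q y) = y) ?invf_div//.
by near: y; exact: fq.
Unshelve. all: by end_near. Qed.

(** At a minimum beyond [a] the left derivative would be nonpositive, so the minimum is at [a].
    Positivity at [b] gives a point with a value strictly below [f b]. *)
Lemma left_derivative_gt0_lt f (a b : R) : a < b -> {within `[a, b], continuous f} ->
  (forall x, a < x <= b -> exists2 l, 0 < l & has_left_derivative f x l) ->
  f a < f b.
Proof.
move=> ab cf hl; have [s sab smin] := EVT_min (ltW ab) cf.
have sa : a = s.
  move: (sab); rewrite in_itv/= => /andP[]; rewrite le_eqVlt => /predU1P[//|as_ sb].
  have [|l l0 hs] := hl s; first by rewrite as_.
  suff : l <= 0 by rewrite leNgt l0.
  rewrite -(cvg_lim _ hs)//; apply: limr_le; first by apply/cvg_ex; exists l.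
  near=> y; have ys : y < s by near: y; exact: nbhs_left_lt.
  have ay : a < y by near: y; exact: nbhs_left_gt.
  rewrite mulr_ge0_le0 ?invr_le0 ?subr_le0 ?(ltW ys)// subr_ge0; apply: smin.
  by rewrite in_itv/= (ltW ay) (ltW (lt_le_trans ys sb)).
have [|l l0 hb] := hl b; first by rewrite ab lexx.
have : \forall y \near b^'-, 0 < (f y - f b) / (y - b) by exact: cvgr_gt hb _ l0.
move=> pos; have [y [yb ay]] : exists y, f y < f b /\ a < y < b.
  near b^'- => y.
  have yb : y < b by near: y; exact: nbhs_left_lt.
  have ay : a < y by near: y; exact: nbhs_left_gt.
  exists y; rewrite ay yb; split=> //.
  have : 0 < (f y - f b) / (y - b) by near: y; exact: pos.
  by rewrite nmulr_lgt0 ?subr_lt0// invr_lt0 subr_lt0.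
apply: le_lt_trans yb; rewrite {1}sa; apply: smin.
by case/andP: ay => ay yb; rewrite in_itv/= !ltW.
Unshelve. all: by end_near. Qed.

(** The strict version applies to [f x + c * x]; the slope [c] is chosen so that the added increment
    is an arbitrary [e]. *)
Lemma left_derivative_ge0_le f (a b : R) : a <= b -> {within `[a, b], continuous f} ->
  (forall x, a < x <= b -> exists2 l, 0 <= l & has_left_derivative f x l) ->
  f a <= f b.
Proof.
rewrite le_eqVlt => /predU1P[->//|ab] cf hl.
apply/ler_addgt0Pr => e e0.
pose c := e / (b - a).
have c0 : 0 < c by rewrite divr_gt0// subr_gt0.
have : f a + c * a < f b + c * b.
  apply: (@left_derivative_gt0_lt (fun x => f x + c * x)) => //.
    move=> x; apply: continuousD; first exact: cf.
    by apply: continuous_subspaceT => {}x; exact: mulrl_continuous.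
  move=> x /hl[l l0 hx]; exists (l + (0 * x + c * 1)).
    by rewrite mul0r add0r mulr1 ltr_wpDl.
  apply: left_derivativeD => //.
  apply: left_derivativeM; first exact: left_derivative_cst.
  exact: left_derivative_id.
rewrite -ltrBrDr => /ltW/le_trans; apply.
rewrite -addrA lerD2l -mulrBr /c mulfVK// subr_eq0.
by rewrite gt_eqF.
Qed.

End left_derivatives.

(** * Convexity through supporting lines *)

Section convex_functions.
Variable R : realType.
Implicit Types (f g v : R -> R).

(** Convexity cleared of denominators, which also covers coinciding points. *)
Lemma convex_three g (x y z : R) : @convex_function R R^o `[0, +oo[ g ->
  0 <= x -> x <= y -> y <= z ->
  (z - x) * g y <= (z - y) * g x + (y - x) * g z.
Proof.
move=> cg x0 xy yz; have [zx|xz] := leP z x.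
  have -> : x = y by apply/le_anti; rewrite xy (le_trans yz).
  have -> : y = z by apply/le_anti; rewrite yz (le_trans zx).
  by rewrite subrr !mul0r addr0.
have zx0 : 0 < z - x by rewrite subr_gt0.
have t0 : 0 <= (z - y) / (z - x) by rewrite divr_ge0 ?subr_ge0// ltW.
have t1 : (z - y) / (z - x) <= 1 by rewrite ler_pdivrMr// mul1r lerD2l lerN2.
set t := (z - y) / (z - x) in t0 t1.
have xD : x \in (`[0, +oo[%classic : set R) by rewrite inE/= in_itv/= x0.
have zD : z \in (`[0, +oo[%classic : set R).
  by rewrite inE/= in_itv/= andbT (le_trans x0)// (le_trans xy).
have : g (t * x + (1 - t) * z) <= t * g x + (1 - t) * g z.
  exact: (cg (Itv01 t0 t1) x z xD zD).
rewrite /t; have -> : (z - y) / (z - x) * x + (1 - (z - y) / (z - x)) * z = y.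
  by field; rewrite gt_eqF.
have -> : (z - y) / (z - x) * g x + (1 - (z - y) / (z - x)) * g z =
    ((z - y) * g x + (y - x) * g z) / (z - x).
  by field; rewrite gt_eqF.
by rewrite ler_pdivlMr// mulrC.
Qed.

Lemma convex_slope g (x y z : R) : @convex_function R R^o `[0, +oo[ g ->
  0 <= x -> 0 <= y -> y < z -> y != x -> z != x ->
  (g y - g x) / (y - x) <= (g z - g x) / (z - x).
Proof.
move=> cg x0 y0 yz; rewrite !neq_lt => /orP[yx|xy] /orP[zx|xz].
- rewrite -[leLHS]mulrNN -invrN -[leRHS]mulrNN -invrN !opprB.
  rewrite ler_pdivrMr ?subr_gt0// mulrAC ler_pdivlMr ?subr_gt0//.
  by have := convex_three cg y0 (ltW yz) (ltW zx); lra.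
- rewrite -[leLHS]mulrNN -invrN !opprB.
  rewrite ler_pdivrMr ?subr_gt0// mulrAC ler_pdivlMr ?subr_gt0//.
  by have := convex_three cg y0 (ltW yx) (ltW xz); lra.
- by have := lt_trans (lt_trans zx xy) yz; rewrite ltxx.
- rewrite ler_pdivrMr ?subr_gt0// mulrAC ler_pdivlMr ?subr_gt0//.
  by have := convex_three cg x0 (ltW xy) (ltW yz); lra.
Qed.

(** The slopes of chords ending at [x] are nondecreasing and, on the left, bounded by the slope to
    [x + 1]; hence the left limit exists, and comparison with the other chords gives the support. *)
Lemma convex_left_support g (x : R) : @convex_function R R^o `[0, +oo[ g -> 0 < x ->
  exists2 l, has_left_derivative g x l & forall z, 0 <= z -> g x + l * (z - x) <= g z.
Proof.
move=> cg x0; pose s y := (g y - g x) / (y - x).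
have scvg : cvg (s y @[y --> x^'-]).
  apply: nondecreasing_at_left_is_cvgr.
    near=> a; have a0 : 0 < a by near: a; exact: nbhs_left_gt.
    move=> y z; rewrite !in_itv/= => /andP[ay yx] /andP[az zx].
    rewrite le_eqVlt => /predU1P[->//|yz].
    by apply: convex_slope; rewrite ?(ltW x0) ?(ltW (lt_trans a0 ay)) ?lt_eqF.
  near=> a; have a0 : 0 < a by near: a; exact: nbhs_left_gt.
  exists (s (x + 1)) => _ [y + <-]; rewrite /= in_itv/= => /andP[ay yx].
  apply: convex_slope; rewrite ?(ltW x0) ?(ltW (lt_trans a0 ay)) ?(lt_eqF yx)//.
    by rewrite (lt_trans yx)// ltrDl.
  by rewrite gt_eqF// ltrDl.
exists (lim (s y @[y --> x^'-])) => // z z0.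
have [->|/[dup] zx] := eqVneq z x; first by rewrite subrr mulr0 addr0.
rewrite neq_lt => /orP[zltx|xz]; rewrite addrC -lerBrDr.
  rewrite -ler_ndivrMr ?subr_lt0//; apply: limr_ge => //.
  near=> y; have yx : y != x by near: y; exact: nbhs_left_neq.
  have zy : z < y by near: y; exact: nbhs_left_gt.
  by apply: convex_slope => //; exact: ltW.
rewrite -ler_pdivlMr ?subr_gt0//; apply: limr_le => //.
near=> y; have yx : y < x by near: y; exact: nbhs_left_lt.
have y0 : 0 < y by near: y; exact: nbhs_left_gt.
by apply: convex_slope => //; rewrite ?(ltW x0) ?(ltW y0) ?(lt_trans yx) ?lt_eqF.
Unshelve. all: by end_near. Qed.

(** Supports at interior points suffice: a convex combination with positive weights equals 0 only
    when both points are 0. *)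
Lemma support_convex g :
  (forall x, 0 < x -> exists l, forall z, 0 <= z -> g x + l * (z - x) <= g z) ->
  @convex_function R R^o `[0, +oo[ g.
Proof.
move=> sg t x y; rewrite !inE/= !in_itv/= !andbT => x0 y0.
have [->|t0] := eqVneq t 0%:i01; first by rewrite !conv0.
have [->|t1] := eqVneq t 1%:i01; first by rewrite !conv1.
have {t0}t0 : 0 < t%:num by rewrite lt_neqAle eq_sym t0 ge0.
have {t1}t1 : t%:num < 1 by rewrite lt_neqAle t1 le1.
set s := t%:num in t0 t1 *.
change (g (s * x + (1 - s) * y) <= s * g x + (1 - s) * g y).
have s10 : 0 < 1 - s by rewrite subr_gt0.
have [m0|m0] := ltP 0 (s * x + (1 - s) * y).
  have [l lP] := sg _ m0.
  move: (lP _ x0) (lP _ y0); set m := s * x + (1 - s) * y => px py.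
  have -> : g m = s * (g m + l * (x - m)) + (1 - s) * (g m + l * (y - m)).
    by rewrite /m; ring.
  by apply: lerD; rewrite ler_pM2l.
have sx : s * x = 0.
  apply/le_anti; rewrite mulr_ge0 ?(ltW t0)// andbT.
  by rewrite (le_trans _ m0)// lerDl mulr_ge0// ltW.
have sy : (1 - s) * y = 0.
  apply/le_anti; rewrite [X in _ && X]mulr_ge0 ?(ltW s10)// andbT.
  by rewrite (le_trans _ m0)// lerDr mulr_ge0// ltW.
rewrite sx sy addr0.
move/eqP : sx; rewrite mulf_eq0 gt_eqF//= => /eqP ->.
move/eqP : sy; rewrite mulf_eq0 gt_eqF//= => /eqP ->.
by rewrite -mulrDl addrCA subrr addr0 mul1r.
Qed.

Lemma continuous_gt0_within f (a b : R) : 0 < a ->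
  (forall x, 0 < x -> {for x, continuous f}) -> {within `[a, b], continuous f}.
Proof.
move=> a0 cf; apply: continuous_in_subspaceT => x; rewrite inE/= in_itv/= => /andP[ax _].
by apply: cf; exact: lt_le_trans ax.
Qed.

(* [f x - x v x] is the intercept of the left tangent line of [f] at [x]. The
   slope [(f z - a) / z], [a] being the intercept at [y], is minimal at [z = y]. *)
Lemma intercept_convex f v : {within `[0, +oo[, continuous f} ->
  (forall x, 0 < x -> has_left_derivative f x (v x)) ->
  (forall x y, 0 < x -> x <= y -> f y - y * v y <= f x - x * v x) ->
  convex_on_Rplus f.
Proof.
move=> cf hf af; split => //; apply: support_convex => y y0; exists (v y).
have /continuous_within_itvcyP[cf0 cf1] := cf.
have cfx x : 0 < x -> {for x, continuous f}.
  by move=> x0; apply: cf0; rewrite in_itv/= x0.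
pose a := f y - y * v y; pose Q z := (f z - a) * z^-1.
have cQ x : 0 < x -> {for x, continuous Q}.
  move=> x0; apply: cvgM; last by apply: cvgV; [rewrite gt_eqF|exact: cvg_id].
  by apply: cvgB; [exact: cfx|exact: cvg_cst].
(* The numerator compares the intercepts at [y] and [x], so it is nonpositive before [y] and
   nonnegative after. *)
have hQ x : 0 < x -> has_left_derivative Q x ((a - (f x - x * v x)) / x ^+ 2).
  move=> x0; have x1 : x != 0 by rewrite gt_eqF.
  have -> : (a - (f x - x * v x)) / x ^+ 2 =
      (v x - 0) * x^-1 + (f x - a) * (- 1 / x ^+ 2) by field.
  apply: left_derivativeM; last by apply: left_derivativeV => //; exact: left_derivative_id.
  by apply: left_derivativeB; [exact: hf|exact: left_derivative_cst].
have main z : 0 < z -> f y + v y * (z - y) <= f z.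
  move=> z0; suff : Q y <= Q z.
    have -> : Q y = v y by rewrite /Q /a; field; rewrite gt_eqF.
    by rewrite /Q ler_pdivlMr// /a; lra.
  have [yz|/ltW zy] := leP y z.
    apply: left_derivative_ge0_le => //; first exact: continuous_gt0_within.
    move=> x /andP[yx xz]; have x0 := lt_trans y0 yx.
    exists ((a - (f x - x * v x)) / x ^+ 2); last exact: hQ.
    by rewrite divr_ge0 ?sqr_ge0// subr_ge0 af// ltW.
  rewrite -lerN2; apply: (@left_derivative_ge0_le _ (fun t => - Q t)) => //.
    by apply: (continuous_gt0_within z0) => x x0; apply: cvgN; exact: cQ.
  move=> x /andP[zx xy]; have x0 := lt_trans z0 zx.
  exists (- ((a - (f x - x * v x)) / x ^+ 2)); last exact/left_derivativeN/hQ.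
  by rewrite -mulNr divr_ge0 ?sqr_ge0// opprB subr_ge0 af.
(* At [z = 0] the inequality follows by letting positive points tend to 0. *)
move=> z; rewrite le_eqVlt => /predU1P[<-|]; last exact: main.
rewrite -(cvg_lim _ cf1)//; 
have cl : f y + v y * (z - y) @[z --> 0^'+] --> f y + v y * (0 - y).
  apply: cvg_at_right_filter; apply: cvgD; first exact: cvg_cst.
  apply: cvgM; first exact: cvg_cst.
  by apply: cvgB; [exact: cvg_id|exact: cvg_cst].
rewrite -(cvg_lim _ cl)//; apply: ler_lim; [by apply/cvg_ex; eexists; exact: cl|
  by apply/cvg_ex; eexists; exact: cf1|].
by near=> t; apply: main; near: t; exact: nbhs_right_gt.
Unshelve. all: by end_near. Qed.

End convex_functions.

(** * Functions of finite variation with a left-continuous control *)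

Section left_controlled_functions.
Variable R : realType.
Implicit Types (a b q V : R -> R).

(* As [V] is nonnegative, the variation of [a] on ]0, T] is finite. *)
Definition left_control V a := [/\ forall s, 0 < s -> 0 <= V s,
  forall s t, 0 < s -> s <= t -> V s <= V t,
  forall s, 0 < s -> V y @[y --> s^'-] --> V s &
  forall s t, 0 < s -> s <= t -> `|a t - a s| <= V t - V s].

Definition left_controlled a := exists V, left_control V a.

Lemma eq_left_controlled a b : (forall s, 0 < s -> a s = b s) ->
  left_controlled a -> left_controlled b.
Proof.
move=> ab [V [V0 Vn Vc Va]]; exists V; split => // s t s0 st.
by rewrite -!ab ?Va// (lt_le_trans s0).
Qed.

Lemma left_controlled_nondecreasing a m : (forall s, 0 < s -> m <= a s) ->
  (forall s t, 0 < s -> s <= t -> a s <= a t) ->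
  (forall s, 0 < s -> a y @[y --> s^'-] --> a s) -> left_controlled a.
Proof.
move=> am an ac; exists (fun s => a s - m); split.
- by move=> s s0; rewrite subr_ge0 am.
- by move=> s t s0 st; rewrite lerD2r an.
- by move=> s s0; apply: cvgB; [exact: ac|exact: cvg_cst].
- by move=> s t s0 st; rewrite opprB addrA subrK ger0_norm// subr_ge0 an.
Qed.

Lemma left_controlled_cst (c : R) : left_controlled (fun=> c).
Proof.
exists (fun=> 0); split => // [s s0|s t s0 st]; first exact: cvg_cst.
by rewrite !subrr normr0.
Qed.

Lemma left_controlledN a : left_controlled a -> left_controlled (fun s => - a s).
Proof.
move=> [V [V0 Vn Vc Va]]; exists V; split => // s t s0 st.
by rewrite -opprD normrN Va.
Qed.

Lemma left_controlledD a b : left_controlled a -> left_controlled b ->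
  left_controlled (fun s => a s + b s).
Proof.
move=> [V [V0 Vn Vc Va]] [W [W0 Wn Wc Wb]]; exists (fun s => V s + W s); split.
- by move=> s s0; rewrite addr_ge0 ?V0 ?W0.
- by move=> s t s0 st; rewrite lerD ?Vn ?Wn.
- by move=> s s0; apply: cvgD; [exact: Vc|exact: Wc].
- move=> s t s0 st; rewrite !opprD addrACA [leRHS]addrACA.
  by rewrite (le_trans (ler_normD _ _))// lerD ?Va ?Wb.
Qed.

Lemma left_controlledB a b : left_controlled a -> left_controlled b ->
  left_controlled (fun s => a s - b s).
Proof. by move=> ca cb; apply: left_controlledD => //; exact: left_controlledN. Qed.

Let left_control_bound V a t : left_control V a -> 0 < t ->
  `|a t| <= `|a 1| + V 1 + V t.
Proof.
move=> [V0 Vn _ Va] t0; have V1 := V0 1 ltr01; have Vt := V0 t t0.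
have : `|a t| <= `|a 1| + `|a t - a 1|.
  by rewrite -{1}(subrK (a 1) (a t)) addrC ler_normD.
have [t1|/ltW t1] := leP t 1.
  by have := Va _ _ t0 t1; rewrite distrC; lra.
by have := Va _ _ ltr01 t1; lra.
Qed.

(** [A] and [B] are nondecreasing bounds of [|a|] and [|b|]. Increments of [A W + B V] dominate
    [A t * (W t - W s) + B s * (V t - V s)], which bounds the increment of the product. *)
Lemma left_controlledM a b : left_controlled a -> left_controlled b ->
  left_controlled (fun s => a s * b s).
Proof.
move=> [V cV] [W cW].
have [V0 Vn Vc Va] := cV; have [W0 Wn Wc Wb] := cW.
pose A s := `|a 1| + V 1 + V s; pose B s := `|b 1| + W 1 + W s.
have A0 s : 0 < s -> 0 <= A s by move=> s0; rewrite !addr_ge0// V0.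
have B0 s : 0 < s -> 0 <= B s by move=> s0; rewrite !addr_ge0// W0.
have An s t : 0 < s -> s <= t -> A s <= A t by move=> *; rewrite lerD2l Vn.
have Bn s t : 0 < s -> s <= t -> B s <= B t by move=> *; rewrite lerD2l Wn.
exists (fun s => A s * W s + B s * V s); split.
- by move=> s s0; rewrite addr_ge0// mulr_ge0 ?A0 ?B0 ?V0 ?W0.
- move=> s t s0 st; have t0 := lt_le_trans s0 st.
  by apply: lerD; apply: ler_pM; rewrite ?A0 ?B0 ?V0 ?W0 ?An ?Bn ?Vn ?Wn.
- move=> s s0; apply: cvgD; apply: cvgM; [|exact: Wc| |exact: Vc].
    by apply: cvgD; [exact: cvg_cst|exact: Vc].
  by apply: cvgD; [exact: cvg_cst|exact: Wc].
- move=> s t s0 st; have t0 := lt_le_trans s0 st.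
  have -> : a t * b t - a s * b s = a t * (b t - b s) + (a t - a s) * b s by ring.
  apply: le_trans (ler_normD _ _) _; rewrite !normrM.
  have h1 : `|a t| * `|b t - b s| <= A t * (W t - W s).
    by apply: ler_pM => //; [exact: left_control_bound|exact: Wb].
  have h2 : `|a t - a s| * `|b s| <= (V t - V s) * B s.
    by apply: ler_pM => //; [exact: Va|exact: left_control_bound].
  have h3 : A s * W s <= A t * W s by rewrite ler_wpM2r ?W0 ?An.
  have h4 : B s * V t <= B t * V t by rewrite ler_wpM2r ?V0 ?Bn.
  by lra.
Qed.

Lemma left_controlledV a m : 0 < m -> (forall s, 0 < s -> m <= a s) ->
  left_controlled a -> left_controlled (fun s => (a s)^-1).
Proof.
move=> m0 am [V [V0 Vn Vc Va]]; exists (fun s => m ^- 2 * V s).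
have m2 : 0 <= m ^- 2 by rewrite invr_ge0 sqr_ge0.
split.
- by move=> s s0; rewrite mulr_ge0 ?V0.
- by move=> s t s0 st; rewrite ler_wpM2l ?Vn.
- by move=> s s0; apply: cvgM; [exact: cvg_cst|exact: Vc].
- move=> s t s0 st; have t0 := lt_le_trans s0 st.
  have as0 := lt_le_trans m0 (am _ s0); have at0 := lt_le_trans m0 (am _ t0).
  have -> : (a t)^-1 - (a s)^-1 = (a s * a t)^-1 * (a s - a t).
    by field; rewrite !gt_eqF.
  rewrite normrM -mulrBr distrC ler_pM// ?Va//.
  rewrite ger0_norm ?invr_ge0 ?mulr_ge0 ?(ltW as0) ?(ltW at0)//.
  rewrite lef_pV2 ?posrE ?exprn_gt0 ?mulr_gt0//.
  by rewrite expr2 ler_pM ?am// ltW.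
Qed.

(** Strict monotonicity makes [q y] approach [q s] from the left, so left continuity passes from [V]
    to [V \o q]. *)
Lemma left_controlled_comp a q : (forall s, 0 < s -> 0 < q s) ->
  (forall s t, 0 < s -> s < t -> q s < q t) ->
  (forall s, 0 < s -> q y @[y --> s^'-] --> q s) ->
  left_controlled a -> left_controlled (a \o q).
Proof.
move=> q0 qn qc [V [V0 Vn Vc Va]]; exists (V \o q).
have qn' s t : 0 < s -> s <= t -> q s <= q t.
  by move=> s0; rewrite le_eqVlt => /predU1P[->//|/(qn _ _ s0)/ltW].
split.
- by move=> s s0; apply/V0/q0.
- by move=> s t s0 st; apply: Vn; [exact: q0|exact: qn'].
- move=> s s0; apply: (@cvg_comp _ _ _ q V _ _ _ _ (Vc _ (q0 _ s0))).
  apply: cvg_at_left_incr; last exact: qc.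
  near=> y; apply: qn; last by near: y; exact: nbhs_left_lt.
  by near: y; exact: nbhs_left_gt.
- by move=> s t s0 st; apply: Va; [exact: q0|exact: qn'].
Unshelve. all: by end_near. Qed.

End left_controlled_functions.

(** * From convexity to tangent intercepts *)

Section difference_of_convex.
Variable R : realType.
Implicit Types (f g k v V : R -> R).

(** The intercept is nonincreasing and at most [g 0], so its opposite, shifted by [g 0], is its own
    control. The work lies in left continuity. *)
Lemma convex_intercept g : convex_on_Rplus g ->
  exists2 v, forall x, 0 < x -> has_left_derivative g x (v x) &
    left_controlled (fun x => g x - x * v x).
Proof.
move=> [cg contg].
have /choice[v vP] : forall x, exists l, 0 < x ->
    has_left_derivative g x l /\ forall z, 0 <= z -> g x + l * (z - x) <= g z.
  move=> x; have [/(convex_left_support cg)[l hl sl]|] := ltP 0 x; first by exists l.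
  by exists 0.
exists v; first by move=> x /vP[].
pose a x := g x - x * v x.
have an s t : 0 < s -> s <= t -> a t <= a s.
  move=> s0 st; have t0 := lt_le_trans s0 st.
  have [_ /(_ t (ltW t0)) h1] := vP s s0; have [_ /(_ s (ltW s0)) h2] := vP t t0.
  have [->//|nst] := eqVneq s t.
  have lt_st : 0 < t - s by rewrite subr_gt0 lt_neqAle nst.
  have : v s <= v t by rewrite -(ler_pM2r lt_st); lra.
  by move=> vst; have := ler_wpM2l (ltW s0) vst; rewrite /a; lra.
rewrite -[X in left_controlled X]/a.
suff : left_controlled (fun x => - a x).
  by move/left_controlledN; apply: eq_left_controlled => s _; rewrite opprK.
apply: (@left_controlled_nondecreasing _ _ (- g 0)).
- move=> s s0; rewrite lerN2; have [_ /(_ 0 (lexx _))] := vP s s0.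
  by rewrite /a; lra.
- by move=> s t s0 st; rewrite lerN2 an.
move=> x x0; apply: cvgN; apply/cvgrPdist_le => e e0.
(* [b w y] is the intercept of the chord through [w] and [y]. It bounds [a y] from above, is left
   continuous in [y] at [x], and [b w x] tends to [a x] as [w] increases to [x]. *)
pose b w y := g y - y * ((g y - g w) / (y - w)).
have ab w y : 0 < w -> w < y -> a y <= b w y.
  move=> w0 wy; have y0 := lt_trans w0 wy.
  have [_ /(_ w (ltW w0)) h] := vP y y0.
  rewrite /a /b lerD2l lerN2 ler_pM2l// ler_pdivrMr ?subr_gt0//; lra.
have bx : b w x @[w --> x^'-] --> a x.
  apply: cvgB; first exact: cvg_cst.
  apply: cvgM; first exact: cvg_cst.
  have [hx _] := vP x x0; apply: (cvg_left_eq _ hx) => w wx.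
  by rewrite -[LHS]mulrNN -invrN !opprB.
have [w [w0 wx bw]] : exists w, [/\ 0 < w, w < x & b w x < a x + e].
  near x^'- => w; exists w; split.
  - by near: w; exact: nbhs_left_gt.
  - by near: w; exact: nbhs_left_lt.
  - by near: w; apply: cvgr_lt bx _ _; rewrite ltrDl.
have gx : g y @[y --> x^'-] --> g x 
  by have [hx _] := vP x x0; exact: left_derivative_cvg hx.
have bwx : b w y @[y --> x^'-] --> b w x.
  apply: cvgB => //; apply: cvgM; first exact: cvg_left_id.
  apply: cvgM; first by apply: cvgB => //; exact: cvg_cst.
  apply: cvgV; first by rewrite subr_eq0 gt_eqF.
  by apply: cvgB; [exact: cvg_left_id|exact: cvg_cst].
near=> y.
have wy : w < y by near: y; exact: nbhs_left_gt.
have yx : y < x by near: y; exact: nbhs_left_lt.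
have axy : a x <= a y by apply: an; [exact: lt_trans wy|exact: ltW].
rewrite ler0_norm ?subr_le0// opprB lerBlDl.
apply: le_trans (ab _ _ w0 wy) _; apply/ltW.
by near: y; exact: cvgr_lt bwx _ bw.
Unshelve. all: by end_near. Qed.

Lemma diff_of_convex_intercept f : diff_of_convex f ->
  [/\ {within `[0, +oo[, continuous f} &
  exists2 v, forall x, 0 < x -> has_left_derivative f x (v x) &
    left_controlled (fun x => f x - x * v x)].
Proof.
move=> [g [k [cg ck fE]]].
have [v hv av] := convex_intercept cg; have [w hw aw] := convex_intercept ck.
split.
  apply: (@subspace_eq_continuous _ _ _ (fun z => g z - k z)).
    by move=> z; rewrite inE/= in_itv/= andbT => z0; exact/esym/fE.
  move=> z; apply: continuousB; first by case: cg => _; exact.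
  by case: ck => _; exact.
exists (fun x => v x - w x) => [x x0|].
  apply: (near_eq_left_derivative _ _ (left_derivativeB (hv _ x0) (hw _ x0))).
    by rewrite fE// ltW.
  near=> y; rewrite fE//; apply/ltW; near: y; exact: nbhs_left_gt.
apply: (eq_left_controlled _ (left_controlledB av aw)) => x x0.
by rewrite fE ?(ltW x0)//; ring.
Unshelve. all: by end_near. Qed.

End difference_of_convex.

(** * From tangent intercepts back to convexity *)

Section convex_primitive.
Variable R : realType.
Implicit Types (f v V W : R -> R).

Let integrable_nondecreasing W (s t : R) : 0 < s ->
  (forall x y, 0 < x -> x <= y -> W x <= W y) ->
  (@lebesgue_measure R).-integrable `[s, t] (EFin \o W).
Proof.
move=> s0 Wn; apply: measurable_bounded_integrable.
- exact: measurable_itv.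
- by rewrite /= lebesgue_measure_itv/=; case: ifP => _; rewrite ?ltry// -EFinB ltry.
- apply: (@eq_measurable_fun _ _ _ _ _ (fun x => W (Num.max s x))).
    by move=> x; rewrite inE/= in_itv/= => /andP[sx _]; rewrite max_r.
  apply: nondecreasing_measurable; first exact: measurable_itv.
  move=> x y xy; apply: Wn; first by rewrite lt_max s0.
  by rewrite ge_max !le_max lexx xy orbT.
- exists (`|W s| + `|W t|); split; first exact: num_real.
  move=> M WM x /=; rewrite in_itv/= => /andP[sx xt].
  rewrite (le_trans _ (ltW WM))//.
  have := Wn _ _ s0 sx; have := Wn _ _ (lt_le_trans s0 sx) xt.
  have := ler_norm (W t); have := ler_norm (- W s); rewrite normrN.
  have := normr_ge0 (W s); have := normr_ge0 (W t).
  by rewrite ler_norml => *; apply/andP; split; lra.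
Qed.

(** The integral from 1, with opposite sign below 1. The bounds on increments replace
    differentiability, as [W] may jump. *)
Lemma nondecreasing_primitive W :
  (forall s t, 0 < s -> s <= t -> W s <= W t) ->
  exists G : R -> R, forall s t, 0 < s -> s <= t ->
    W s * (t - s) <= G t - G s <= W t * (t - s).
Proof.
move=> Wn; pose mu := @lebesgue_measure R.
pose J s t := \int[mu]_(x in `[s, t]) W x.
have Jadd r s t : 0 < r -> r <= s -> s <= t -> J r t = J r s + J s t.
  move=> r0 rs st; have s0 := lt_le_trans r0 rs.
  apply/eqP; rewrite addrC -subr_eq; apply/eqP.
  rewrite /J Rintegral_itvB ?bnd_simp//; last exact: integrable_nondecreasing.
  rewrite Rintegral_itv_obnd_cbnd//.
  apply: integrableS (integrable_nondecreasing t s0 Wn) => //; exact: subset_itv_oc_cc.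
have Jb s t : 0 < s -> s <= t -> W s * (t - s) <= J s t <= W t * (t - s).
  move=> s0 st.
  have muE : fine (mu `[s, t]%classic) = t - s.
    rewrite /mu lebesgue_measure_itv/= lte_fin; case: ltP => //= ts.
    by have /le_anti -> : s <= t <= s; [rewrite st ts|rewrite subrr].
  have mI : measurable (`[s, t]%classic : set R) by exact: measurable_itv.
  have cI (c : R) : mu.-integrable `[s, t] (EFin \o cst c).
    apply: measurable_bounded_integrable => //; last exact: bounded_cst.
    by rewrite /= /mu lebesgue_measure_itv/=; case: ifP => _; rewrite ?ltry// -EFinB ltry.
  rewrite -muE -!Rintegral_cst//; apply/andP; split.
    apply: le_Rintegral => //; [exact: cI|exact: integrable_nondecreasing|].
    by move=> x /=; rewrite in_itv/= => /andP[sx _]; exact: Wn.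
  apply: le_Rintegral => //; [exact: integrable_nondecreasing|exact: cI|].
  by move=> x /=; rewrite in_itv/= => /andP[sx xt]; apply: Wn => //; exact: lt_le_trans sx.
exists (fun t => if 1 <= t then J 1 t else - J t 1) => s t s0 st.
suff -> : (if 1 <= t then J 1 t else - J t 1) - (if 1 <= s then J 1 s else - J s 1) = J s t.
  exact: Jb.
case: (leP 1 t) => t1; case: (leP 1 s) => s1.
- by rewrite (Jadd 1 s t)// addrAC subrr add0r.
- by rewrite opprK (Jadd s 1 t)// 1?addrC// ltW.
- by have := le_lt_trans (le_trans s1 st) t1; rewrite ltxx.
- by rewrite opprK (Jadd s t 1)// ?ltW// addrC addrK.
Qed.

(* Witness: [x \int_1^x V(s) / s^2 ds], the perspective [x G(1/x)] of the
   convex function [G(r) = - \int_1^r V(1/s) ds]. *)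
Lemma intercept_primitive V : (forall s, 0 < s -> 0 <= V s) ->
  (forall s t, 0 < s -> s <= t -> V s <= V t) ->
  (forall s, 0 < s -> V y @[y --> s^'-] --> V s) ->
  exists (g v : R -> R) (c : R), [/\ {within `[0, +oo[, continuous g},
    forall x, 0 < x -> has_left_derivative g x (v x) &
    forall x, 0 < x -> g x - x * v x = c - V x].
Proof.
move=> V0 Vn Vc; pose S := [set V s | s in `]0, +oo[].
have infS : has_inf S.
  split; first by exists (V 1), 1 => //=; rewrite in_itv/= ltr01.
  by exists 0 => _ [s + <-]; rewrite /= in_itv/= andbT; exact: V0.
(* [l] is the right limit of [V] at 0; subtracting it makes [U] vanish at 0, which gives continuity
   of the witness there. *)
pose l := inf S.
pose U s := V s - l.
have U0 s : 0 < s -> 0 <= U s.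
  move=> s0; rewrite subr_ge0; apply: ge_inf; first by case: infS.
  by exists s => //=; rewrite in_itv/= s0.
have Un s t : 0 < s -> s <= t -> U s <= U t by move=> *; rewrite lerD2r Vn.
have Uc s : 0 < s -> U y @[y --> s^'-] --> U s.
  by move=> s0; apply: cvgB; [exact: Vc|exact: cvg_cst].
have Ue e : 0 < e -> exists2 s, 0 < s & U s < e.
  move=> e0; have [_ [s + <-] se] := inf_adherent e0 infS.
  by rewrite /= in_itv/= andbT => s0; exists s => //; rewrite ltrBlDl.
have [G GP] : exists G : R -> R, forall s t, 0 < s -> s <= t ->
    (- U s^-1) * (t - s) <= G t - G s <= (- U t^-1) * (t - s).
  apply: (nondecreasing_primitive (W := fun s => - U s^-1)) => s t s0 st.
  have t0 := lt_le_trans s0 st.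
  by rewrite lerN2 Un ?invr_gt0// lef_pV2// posrE.
(* Up to a constant, [N x] is the integral of [U s / s ^ 2] from 1 to [x], by the substitution
   [s = 1 / r]. *)
pose N x := G x^-1.
have NP t x : 0 < t -> t <= x ->
    U t * (t^-1 - x^-1) <= N x - N t <= U x * (t^-1 - x^-1).
  move=> t0 tx; have x0 := lt_le_trans t0 tx.
  have : x^-1 <= t^-1 by rewrite lef_pV2// posrE.
  have xV0 : 0 < x^-1 by rewrite invr_gt0.
  move=> /(GP _ _ xV0); rewrite !invrK => /andP[h1 h2].
  by rewrite /N; apply/andP; split; lra.
have hN x : 0 < x -> has_left_derivative N x (U x / x ^+ 2).
  move=> x0; have x1 : x != 0 by rewrite gt_eqF.
  have cV : (y * x)^-1 @[y --> x^'-] --> (x ^+ 2)^-1.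
    apply: cvgV; first by rewrite sqrf_eq0.
    by apply: cvgM; [exact: cvg_left_id|exact: cvg_cst].
  apply: (@squeeze_cvgr _ _ _ _ (fun y => U y * (y * x)^-1) (fun y => U x * (y * x)^-1)).
  - near=> y; have yx : y < x by near: y; exact: nbhs_left_lt.
    have y0 : 0 < y by near: y; exact: nbhs_left_gt.
    have /andP[h1 h2] := NP y x y0 (ltW yx).
    have E : y^-1 - x^-1 = (x - y) * (y * x)^-1 by field; rewrite !gt_eqF.
    have xy : 0 < x - y by rewrite subr_gt0.
    rewrite -[X in _ <= X <= _]mulrNN -invrN !opprB.
    rewrite ler_pdivlMr// ler_pdivrMr//.
    by rewrite -!mulrA ![(y * x)^-1 * _]mulrC -E h1 h2.
  - by apply: cvgM cV; exact: Uc.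
  - by apply: cvgM cV; exact: cvg_cst.
have cN x : 0 < x -> {for x, continuous N}.
  move=> x0; have x1 : x != 0 by rewrite gt_eqF.
  have cB : U (2 * x) * `|y^-1 - x^-1| @[y --> x] --> 0.
    rewrite -(mulr0 (U (2 * x))); apply: cvgM; first exact: cvg_cst.
    rewrite [X in _ --> X](_ : _ = `|x^-1 - x^-1|); last by rewrite subrr normr0.
    apply: cvg_norm.
    apply: cvgB; last exact: cvg_cst.
    by apply: cvgV => //; exact: cvg_id.
  have cD : N y - N x @[y --> x] --> 0.
    apply: (@squeeze_cvgr _ _ _ _ (fun y => - (U (2 * x) * `|y^-1 - x^-1|))
      (fun y => U (2 * x) * `|y^-1 - x^-1|)) => //.
      near=> y.
      have y0 : 0 < y by near: y; exact: lt_nbhsr.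
      have y2 : y < 2 * x by near: y; apply: lt_nbhsl; rewrite ltr_pMl// ltr1n.
      have x2 : x <= 2 * x by rewrite ler_peMl ?ler1n// ltW.
      rewrite -ler_norml.
      have [yx|/ltW xy] := leP y x.
        have /andP[h1 h2] := NP _ _ y0 yx.
        have yV : 0 <= y^-1 - x^-1 by rewrite subr_ge0 lef_pV2// posrE.
        rewrite distrC ger0_norm; last by apply: le_trans h1; rewrite mulr_ge0 ?U0.
        by rewrite ger0_norm// (le_trans h2)// ler_wpM2r// Un.
      have /andP[h1 h2] := NP _ _ x0 xy.
      have yV : 0 <= x^-1 - y^-1 by rewrite subr_ge0 lef_pV2// posrE.
      rewrite ger0_norm; last by apply: le_trans h1; rewrite mulr_ge0 ?U0.
      by rewrite distrC ger0_norm// (le_trans h2)// ler_wpM2r// Un// ltW.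
    by rewrite -[X in _ --> X]oppr0; exact: cvgN.
  by apply/subr_cvg0.
pose g x := x * N x.
exists g, (fun x => N x + U x / x), l; split.
- apply/continuous_within_itvcyP; split.
    move=> x; rewrite in_itv/= andbT => x0.
    by apply: cvgM; [exact: cvg_id|exact: cN].
  rewrite {2}/g mul0r; apply/cvgrPdist_le => e e0.
  have e2 : 0 < e / 2 by rewrite divr_gt0.
  (* For fixed [s], [y * N s] vanishes with [y], while [y * (N s - N y)] is at most [U s], hence
     below [e / 2]. *)
  have [s s0 Us] := Ue _ e2.
  near=> y.
  have y0 : 0 < y by near: y; exact: nbhs_right_gt.
  have ys : y < s by near: y; exact: nbhs_right_lt.
  have yN : y * `|N s| <= e / 2.
    have : y < e / 2 / (`|N s| + 1) 
      by near: y; apply: nbhs_right_lt; rewrite divr_gt0// ltr_wpDl.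
    rewrite ltr_pdivlMr ?ltr_wpDl// => /ltW; apply: le_trans.
    by rewrite ler_pM2l// lerDl.
  have /andP[h1 h2] := NP _ _ y0 (ltW ys).
  have yV : 0 <= y^-1 - s^-1 by rewrite subr_ge0 lef_pV2 ?posrE// ltW.
  have -> : 0 - g y = - (y * N s) + y * (N s - N y) by rewrite /g; ring.
  apply: le_trans (ler_normD _ _) _; rewrite [leRHS]splitr; apply: lerD.
    by rewrite normrN normrM (ger0_norm (ltW y0)).
  rewrite ger0_norm; last first.
    by rewrite mulr_ge0 ?(ltW y0)// (le_trans _ h1)// mulr_ge0// U0.
  apply: le_trans (ltW Us).
  apply: (@le_trans _ _ (y * (U s * (y^-1 - s^-1)))); first by rewrite ler_pM2l.
  rewrite mulrCA ler_piMr ?U0// mulrBr mulfV ?gt_eqF// gerBl.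
  by rewrite mulr_ge0 ?(ltW y0)// invr_ge0 ltW.
- move=> x x0; have -> : N x + U x / x = 1 * N x + x * (U x / x ^+ 2).
    by field; rewrite gt_eqF.
  by apply: left_derivativeM; [exact: left_derivative_id|exact: hN].
- by move=> x x0; rewrite /g /U; field; rewrite gt_eqF.
Unshelve. all: by end_near. Qed.

(** Half the sum and half the difference of [g] and [f] have intercepts built from [c - V] plus or
    minus that of [f]. These are nonincreasing because [V] controls the latter, so both functions
    are convex. *)
Lemma left_controlled_diff_of_convex f v : {within `[0, +oo[, continuous f} ->
  (forall x, 0 < x -> has_left_derivative f x (v x)) ->
  left_controlled (fun x => f x - x * v x) -> diff_of_convex f.
Proof.
move=> cf hf [V [V0 Vn Vc Va]].
have [g [w [c [cg hg ag]]]] := intercept_primitive V0 Vn Vc.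
have main (e : R) : `|e| = 1 -> convex_on_Rplus (fun z => 2^-1 * (g z + e * f z)).
  move=> e1; apply: (@intercept_convex _ _ (fun x => 2^-1 * (w x + e * v x))).
  - move=> x; apply: cvgM; first exact: cvg_cst.
    apply: cvgD; first exact: cg.
    by apply: cvgM; [exact: cvg_cst|exact: cf].
  - move=> x x0.
    have -> : 2^-1 * (w x + e * v x) =
      0 * (g x + e * f x) + 2^-1 * (w x + (0 * f x + e * v x)) by ring.
    apply: left_derivativeM; first exact: left_derivative_cst.
    apply: left_derivativeD; first exact: hg.
    by apply: left_derivativeM; [exact: left_derivative_cst|exact: hf].
  - move=> x y x0 xy; have y0 := lt_le_trans x0 xy.
    have E z : 0 < z -> 2^-1 * (g z + e * f z) - z * (2^-1 * (w z + e * v z)) =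
        2^-1 * (c - V z + e * (f z - z * v z)).
      by move=> /ag <-; ring.
    rewrite !E// ler_pM2l ?invr_gt0//.
    have := Va x y x0 xy; rewrite -[leLHS]mul1r -e1 -normrM.
    move=> /(le_trans (ler_norm _)); lra.
exists (fun z => 2^-1 * (g z + 1 * f z)), (fun z => 2^-1 * (g z + (-1) * f z)).
by split; [apply: main; rewrite normr1|apply: main; rewrite normrN1|move=> z _; field].
Qed.

End convex_primitive.

(** * Composition with the inverse of [h] *)

Section inverse_of_elastic_function.
Variables (R : realType) (beta : R) (I q : R -> R).
Hypothesis beta_gt0 : 0 < beta.
Hypothesis dcI : diff_of_convex I.
Hypothesis I_gt0 : forall x, 0 < x -> 0 < I x.
Hypothesis I_noninc : forall x y, 0 < x -> x <= y -> I y <= I x.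
Hypothesis q_at0 : q 0 = 0.
Hypothesis q_gt0 : forall x, 0 < x -> 0 < q x.
Hypothesis q_incr : forall x y, 0 < x -> x < y -> q x < q y.
Hypothesis q_cont : {within `[0, +oo[, continuous q}.
Hypothesis hq : forall x, 0 < x -> q x `^ (1 + beta) / I (q x) = x.

Let q_left x : 0 < x -> q y @[y --> x^'-] --> q x.
Proof.
move=> x0; apply: cvg_at_left_filter.
by have /continuous_within_itvcyP[qc _] := q_cont; apply: qc; rewrite in_itv/= x0.
Qed.

Let q_lt x : 0 < x -> \forall y \near x^'-, q y < q x.
Proof.
move=> x0; near=> y; apply: q_incr; last by near: y; exact: nbhs_left_lt.
by near: y; exact: nbhs_left_gt.
Unshelve. all: by end_near. Qed.

(* [E p] is the elasticity [p h'(p) / h(p)] of [h p = p^(1+beta) / I p]; it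
   depends on [I'] only through the intercept [I p - p I'(p)]. *)
Let elasticity : exists E : R -> R, [/\ forall p, 0 < p -> 1 + beta <= E p,
  left_controlled E & forall x, 0 < x -> has_left_derivative q x (q x / (x * E (q x)))].
Proof.
have [cI [i hi ai]] := diff_of_convex_intercept dcI.
exists (fun p => beta + (I p - p * i p) * (I p)^-1).
have i_le0 p : 0 < p -> i p <= 0.
  move=> p0; rewrite -(cvg_lim _ (hi _ p0))//; apply: limr_le.
    by apply/cvg_ex; exists (i p); exact: hi.
  near=> y; have yp : y < p by near: y; exact: nbhs_left_lt.
  have y0 : 0 < y by near: y; exact: nbhs_left_gt.
  by rewrite mulr_ge0_le0 ?invr_le0 ?subr_le0 ?subr_ge0 ?(ltW yp)// I_noninc// ltW.
have E1 p : 0 < p -> 1 + beta <= beta + (I p - p * i p) * (I p)^-1.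
  move=> p0; rewrite addrC lerD2l mulrDl mulfV ?gt_eqF ?I_gt0// lerDl.
  rewrite mulr_ge0// ?invr_ge0 ?(ltW (I_gt0 p0))// oppr_ge0.
  by rewrite mulr_ge0_le0 ?i_le0// ltW.
have I_left p : 0 < p -> I y @[y --> p^'-] --> I p.
  by move=> p0; exact: left_derivative_cvg (hi _ p0).
split => // [|x x0].
  apply: left_controlledD; first exact: left_controlled_cst.
  apply: left_controlledM => //; apply: (@left_controlled_nondecreasing _ _ 0).
  - by move=> s s0; rewrite invr_ge0 ltW// I_gt0.
  - move=> s t s0 st; have t0 := lt_le_trans s0 st.
    by rewrite lef_pV2 ?posrE ?I_gt0// I_noninc.
  - by move=> s s0; apply: cvgV; [rewrite gt_eqF// I_gt0|exact: I_left].
set p := q x; have p0 : 0 < p by exact: q_gt0.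
have Ip := I_gt0 p0.
set E := _ + _; have E0 : 0 < E by apply: lt_le_trans (E1 _ p0); rewrite addr_gt0.
have -> : p / (x * E) = (x * E / p)^-1 by rewrite invf_div.
apply: (@left_derivative_inverse _ (fun p => p `^ (1 + beta) / I p)).
- by rewrite !mulf_neq0 ?invr_eq0 ?gt_eqF.
- exact: q_lt.
- exact: q_left.
- by near=> y; apply: hq; near: y; exact: nbhs_left_gt.
- exact: hq.
(* The left derivative of [h] at [p] by the product rule, rewritten using [x = h p]. *)
have -> : x * E / p = ((1 + beta) * p `^ (1 + beta - 1)) * (I p)^-1 +
    p `^ (1 + beta) * (- i p / I p ^+ 2).
  rewrite -{1}(hq x0) -/p -(@mulr_powRB1 _ p (1 + beta)) ?ltW ?addr_gt0// /E.
  by field; rewrite !gt_eqF.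
apply: left_derivativeM; first exact: left_derivative_powR.
by apply: left_derivativeV; [rewrite gt_eqF|exact: hi].
Unshelve. all: by end_near. Qed.

Lemma left_derivative_gt0_inverse x : 0 < x -> left_derivative_gt0 q x.
Proof.
move=> x0; have [E [E1 _ hqE]] := elasticity; exists (q x / (x * E (q x))).
  have := E1 _ (q_gt0 x0) => /(lt_le_trans _) E0.
  by rewrite divr_gt0 ?q_gt0// mulr_gt0// E0// addr_gt0.
exact: hqE.
Qed.

Lemma left_derivative_gt0_comp_inverse f x : 0 < x ->
  left_derivative_gt0 f (q x) -> left_derivative_gt0 (f \o q) x.
Proof.
move=> x0 [l l0 hf]; have [m m0 hm] := left_derivative_gt0_inverse x0.
exists (l * m); first by rewrite mulr_gt0.
by apply: left_derivative_comp_incr => //; exact: q_lt.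
Qed.

Lemma diff_of_convex_comp_inverse f : diff_of_convex f ->
  (forall x, 0 < x -> 0 <= f x) ->
  (forall x y, 0 < x -> x <= y -> f x <= f y) -> diff_of_convex (f \o q).
Proof.
move=> dcf f0 fn; have [cf [v hv av]] := diff_of_convex_intercept dcf.
have [E [E1 cE hqE]] := elasticity.
have E0 p : 0 < p -> 0 < E p.
  by move=> p0; apply: lt_le_trans (E1 _ p0); rewrite addr_gt0.
have /continuous_within_itvcyP[qc qc0] := q_cont.
have /continuous_within_itvcyP[fc fc0] := cf.
have cfq : {within `[0, +oo[, continuous (f \o q)}.
  apply/continuous_within_itvcyP; split.
    move=> x; rewrite in_itv/= andbT => x0.
    apply: continuous_comp; first by apply: qc; rewrite in_itv/= x0.
    by apply: fc; rewrite in_itv/= q_gt0.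
  rewrite /= q_at0.
  apply: (@cvg_comp _ _ _ q f _ 0^'+ _ _ fc0).
  move=> A; rewrite q_at0 in qc0; move=> /qc0 qA.
  suff : \forall y \near 0^'+, A (q y) by [].
  near=> y; have : 0 < q y by apply: q_gt0; near: y; exact: nbhs_right_gt.
  by near: y; exact: qA.
apply: (left_controlled_diff_of_convex
  (v := fun x => v (q x) * (q x / (x * E (q x))))) => //.
  move=> x x0; apply: (left_derivative_comp_incr (f := f)); 
    [exact: q_lt|exact/hv/q_gt0|exact: hqE].
(* [T] gives the intercept of [f \o q] at [p = q x]. The term [p * v p] is written as [f p] minus
   the intercept of [f], both known to be left-controlled. *)
pose T p := f p - (f p - (f p - p * v p)) * (E p)^-1.
apply: (eq_left_controlled (a := T \o q)).
  move=> x x0; rewrite /T/=.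
  have x1 : x != 0 by rewrite gt_eqF.
  have E1' : E (q x) != 0 by rewrite gt_eqF// E0// q_gt0.
  by field; rewrite E1' x1.
apply: left_controlled_comp => //.
have clf : left_controlled f.
  apply: (@left_controlled_nondecreasing _ _ 0) => // s s0.
  exact: left_derivative_cvg (hv _ s0).
apply: left_controlledB => //; apply: left_controlledM; first exact: left_controlledB.
by apply: (@left_controlledV _ _ (1 + beta)) => //; rewrite addr_gt0.
Unshelve. all: by end_near. Qed.

End inverse_of_elastic_function.

(** * The operator I and the inverse of h *)

Section increasing_functions_on_Rplus.
Variable R : realType.
Implicit Types (f g : R -> R).

Lemma within_Rplus_sub f (a b : R) : 0 <= a ->
  {within `[0, +oo[, continuous f} -> {within `[a, b], continuous f}.
Proof.
move=> a0 cf; apply: continuous_subspaceW cf => x /=; rewrite !in_itv/= andbT.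
by move=> /andP[/(le_trans a0)].
Qed.

Lemma left_derivative_gt0_increasing f : {within `[0, +oo[, continuous f} ->
  (forall x, 0 < x -> left_derivative_gt0 f x) ->
  forall x y, 0 <= x -> x < y -> f x < f y.
Proof.
move=> cf hf x y x0 xy; apply: left_derivative_gt0_lt => //.
  exact: within_Rplus_sub.
by move=> z /andP[xz _]; apply: hf; exact: le_lt_trans xz.
Qed.

Lemma within_Rplus_comp f g : {within `[0, +oo[, continuous f} ->
  continuous g -> (forall x, 0 <= g x) -> continuous (f \o g).
Proof.
move=> /subspace_continuousP cf cg g0 x A.
have gx0 : (`[0, +oo[%classic : set R) (g x) by rewrite /= in_itv/= g0.
move=> /(cf _ gx0) /= /cg /= gA.
suff : \forall y \near x, A (f (g y)) by [].
near=> y; have : (`[0, +oo[%classic : set R) (g y) -> A (f (g y)).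
  by near: y; exact: gA.
by apply; rewrite /= in_itv/= g0.
Unshelve. all: by end_near. Qed.

Section inverse.
Variable h : R -> R.
Hypothesis h_at0 : h 0 = 0.
Hypothesis h_incr : forall x y, 0 <= x -> x < y -> h x < h y.
Hypothesis h_cont : {within `[0, +oo[, continuous h}.
Hypothesis h_unbounded : forall A, exists2 x, 0 <= x & A <= h x.
Local Notation Rplus := (`[0, +oo[%classic : set R).
Local Notation q := (pinv Rplus h).

Let h_le x y : 0 <= x -> x <= y -> h x <= h y.
Proof. by move=> x0; rewrite le_eqVlt => /predU1P[->//|/(h_incr x0)/ltW]. Qed.

Let RplusP x : Rplus x <-> 0 <= x.
Proof. by rewrite /= in_itv/= andbT. Qed.

Lemma increasing_set_bij : set_bij Rplus Rplus h.
Proof.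
split => [x /RplusP x0|x y|y /RplusP y0].
- by apply/RplusP; rewrite -h_at0 h_le.
- rewrite !inE => /RplusP x0 /RplusP y0 hxy.
  have [xy|yx|//] := ltgtP x y.
    by have := h_incr x0 xy; rewrite hxy ltxx.
  by have := h_incr y0 yx; rewrite hxy ltxx.
- have [x x0 yx] := h_unbounded y.
  have [||z] := @IVT _ h 0 x y x0.
  + exact: within_Rplus_sub.
  + by rewrite h_at0 min_l ?max_r ?y0// -h_at0 h_le.
  + by rewrite in_itv/= => /andP[z0 _] <-; exists z => //; apply/RplusP.
Qed.

Lemma inverse_ge0 x : 0 <= x -> 0 <= q x.
Proof.
move=> /RplusP x0; have [qf _ _] : set_bij Rplus Rplus q.
  exact: bijpinv_bij increasing_set_bij.
by apply/RplusP; exact: qf.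
Qed.

Lemma inverseK x : 0 <= x -> h (q x) = x.
Proof.
move=> /RplusP x0; have [_ _ hs] := increasing_set_bij.
by apply: pinvK; rewrite inE; exact: hs.
Qed.

Lemma Kinverse x : 0 <= x -> q (h x) = x.
Proof.
move=> /RplusP x0; have [_ hi _] := increasing_set_bij.
by apply: pinvKV => //; rewrite inE.
Qed.

Lemma inverse_at0 : q 0 = 0.
Proof. by have := Kinverse (lexx 0); rewrite h_at0. Qed.

Lemma inverse_lt x y : 0 <= x -> x < y -> q x < q y.
Proof.
move=> x0 xy; have y0 := le_trans x0 (ltW xy).
rewrite ltNge; apply/negP => /(h_le (inverse_ge0 y0)).
by rewrite !inverseK// leNgt xy.
Qed.

Lemma inverse_le x y : 0 <= x -> x <= y -> q x <= q y.
Proof. by move=> x0; rewrite le_eqVlt => /predU1P[->//|/(inverse_lt x0)/ltW]. Qed.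

Lemma inverse_gt0 x : 0 < x -> 0 < q x.
Proof. by move=> x0; have := inverse_lt (lexx 0) x0; rewrite inverse_at0. Qed.

Lemma inverse_leP x p : 0 <= x -> 0 <= p -> (q x <= p) = (x <= h p).
Proof.
move=> x0 p0; apply/idP/idP => [/(h_le (inverse_ge0 x0))|].
  by rewrite inverseK.
by move=> /(inverse_le x0); rewrite Kinverse.
Qed.

Lemma inverse_ltP x p : 0 <= x -> 0 <= p -> (p < q x) = (h p < x).
Proof. by move=> x0 p0; rewrite !ltNge inverse_leP. Qed.

Lemma inverse_ltP' x p : 0 <= x -> 0 <= p -> (q x < p) = (x < h p).
Proof.
move=> x0 p0; apply/idP/idP => [/(h_incr (inverse_ge0 x0))|].
  by rewrite inverseK.
by move=> /(inverse_lt x0); rewrite Kinverse.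
Qed.

(** [q y] is within [e] of [q x] when [y] lies strictly between [h (q x - e)] and [h (q x + e)]. If
    [q x - e] is negative, the lower bound holds trivially. *)
Lemma inverse_continuous : {within Rplus, continuous q}.
Proof.
have hlt x e : 0 <= x -> 0 < e -> x < h (q x + e).
  by move=> x0 e0; rewrite -inverse_ltP' ?ltrDl// addr_ge0 ?(ltW e0)// inverse_ge0.
apply/continuous_within_itvcyP; split.
  move=> x; rewrite in_itv/= andbT => x0; apply/cvgrPdist_lt => e e0.
  have hx : \forall y \near x, 0 <= q x - e -> h (q x - e) < y.
    have [qe0|qe0] := ltP (q x - e) 0; first by near=> y.
    have : \forall y \near x, h (q x - e) < y.
      by apply: lt_nbhsr; rewrite -(inverse_ltP (ltW x0) qe0) gtrBl.
    by apply: filterS => y ?.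
  near=> y.
  have y0 : 0 < y by near: y; exact: lt_nbhsr.
  have yq : q y < q x + e.
    rewrite inverse_ltP' ?(ltW y0) ?addr_ge0 ?(ltW e0) ?inverse_ge0 ?(ltW x0)//.
    by near: y; apply: lt_nbhsl; exact: hlt (ltW x0) e0.
  have qy : q x - e < q y.
    have [qe0|qe0] := ltP (q x - e) 0; first exact: lt_le_trans (inverse_ge0 (ltW y0)).
    rewrite (inverse_ltP (ltW y0) qe0); move: qe0; near: y; exact: hx.
  by rewrite distrC ltr_norml; apply/andP; split; lra.
rewrite inverse_at0; apply/cvgrPdist_lt => e e0; near=> y.
have y0 : 0 < y by near: y; exact: nbhs_right_gt.
rewrite sub0r normrN ger0_norm ?inverse_ge0 ?(ltW y0)// inverse_ltP' ?(ltW y0) ?(ltW e0)//.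
by near: y; apply: nbhs_right_lt; rewrite -h_at0 h_incr.
Unshelve. all: by end_near. Qed.

Lemma inverse_cvgy : q x @[x --> +oo] --> +oo.
Proof.
apply/cvgryPge => A; near=> x.
have x0 : 0 <= x by near: x; apply: nbhs_pinfty_ge; exact: num_real.
apply: (@le_trans _ _ (Num.max A 0)); first by rewrite le_max lexx.
have A0 : 0 <= Num.max A 0 by rewrite le_max lexx orbT.
rewrite leNgt inverse_ltP'// -leNgt.
by near: x; apply: nbhs_pinfty_ge; exact: num_real.
Unshelve. all: by end_near. Qed.

End inverse.
End increasing_functions_on_Rplus.

Lemma continuous_powR (R : realType) (p x : R) : 0 < x ->
  {for x, continuous (fun y => y `^ p)}.
Proof.
move=> x0; apply: differentiable_continuous; apply/derivable1_diffP.
by apply: derivable_powR; rewrite in_itv/= x0.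
Qed.

Lemma max_powR (R : realType) (a x y : R) : 0 <= a -> 0 <= x -> 0 <= y ->
  Num.max (x `^ a) (y `^ a) = (Num.max x y) `^ a.
Proof.
move=> a0 x0 y0; have [xy|/ltW yx] := leP x y.
  by rewrite max_r ?ge0_ler_powR.
by rewrite max_l ?ge0_ler_powR.
Qed.

Lemma measurable_fun_powR2 d (T : measurableType d) (R : realType) (f g : T -> R) :
  (forall i, 0 < f i) -> measurable_fun setT f -> measurable_fun setT g ->
  measurable_fun setT (fun i => f i `^ g i).
Proof.
move=> f0 mf mg.
apply: (eq_measurable_fun (fun i => expR (g i * ln (f i)))).
  by move=> i _; rewrite /powR gt_eqF.
apply: measurableT_comp; first exact: measurable_expR.
apply: measurable_funM => //.
by apply: measurableT_comp => //; exact: measurable_ln.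
Qed.

(** * Positivity, monotonicity and continuity of the operator *)

Section opI_theory.
Context {d : measure_display} {I : measurableType d} {R : realType}.
Variables (iota : {measure set I -> \bar R}) (c alpha lambda : I -> R).
Variables (beta gamma : R) (X : I -> R -> R).
Hypothesis iotaT : (0 < iota [set: I])%E.
Hypothesis mc : measurable_fun [set: I] c.
Hypothesis malpha : measurable_fun [set: I] alpha.
Hypothesis mlambda : measurable_fun [set: I] lambda.
Hypothesis c_gt0 : forall i, 0 < c i.
Hypothesis alpha_gt0 : forall i, 0 < alpha i.
Hypothesis lambda_gt0 : forall i, 0 < lambda i.
Hypothesis kappa_fin : (\int[iota]_i (lambda i * c i `^ alpha i)%:E < +oo)%E.
Hypothesis beta_gt0 : 0 < beta.
Hypothesis gamma_gt0 : 0 < gamma.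
Hypothesis XB : in_B iota alpha lambda X.

Lemma in_B_continuous i : {within `[0, +oo[, continuous (X i)}.
Proof. by have [_ _ /(_ i)[/diff_of_convex_intercept[]]] := XB. Qed.

Lemma in_B_at0 i : X i 0 = 0.
Proof.
have [_ _ /(_ i)[_ X0 _ _]] := XB.
have /continuous_within_itvcyP[_ X0'] := @in_B_continuous i.
exact: cvg_unique X0' X0.
Qed.

Lemma in_B_increasing i x y : 0 <= x -> x < y -> X i x < X i y.
Proof.
have [_ _ /(_ i)[_ _ _ hX]] := XB.
by apply: left_derivative_gt0_increasing => //; exact: in_B_continuous.
Qed.

Lemma in_B_nondecreasing i x y : 0 <= x -> x <= y -> X i x <= X i y.
Proof.
by move=> x0; rewrite le_eqVlt => /predU1P[->//|/(in_B_increasing i x0)/ltW].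
Qed.

Lemma in_B_gt0 i x : 0 < x -> 0 < X i x.
Proof. by move=> x0; rewrite -(in_B_at0 i) in_B_increasing. Qed.

Lemma in_B_ge0 i x : 0 <= x -> 0 <= X i x.
Proof. by move=> x0; rewrite -(in_B_at0 i) in_B_nondecreasing. Qed.

Let K i := lambda i * c i `^ alpha i.
Let F z i := lambda i * Num.max (c i `^ alpha i) (X i z `^ alpha i).

Let alpha_ge0 i : 0 <= alpha i. Proof. exact: ltW. Qed.

Let K_gt0 i : 0 < K i.
Proof. by rewrite mulr_gt0// powR_gt0. Qed.

Let K_le z i : K i <= F z i.
Proof. by rewrite ler_pM2l// le_max lexx. Qed.

Let F_gt0 z i : 0 < F z i.
Proof. exact: lt_le_trans (K_gt0 i) (K_le z i). Qed.

Let F_le x y i : 0 <= x -> x <= y -> F x i <= F y i.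
Proof.
move=> x0 xy; rewrite ler_pM2l// ge_max le_max lexx/= le_max; apply/orP; right.
apply: ge0_ler_powR => //; last exact: in_B_nondecreasing.
  by rewrite nnegrE in_B_ge0.
by rewrite nnegrE in_B_ge0// (le_trans x0).
Qed.

Let mX z : 0 <= z -> measurable_fun [set: I] (X^~ z).
Proof.
move=> z0; have [m _ _] := XB.
apply: (measurable_comp (F := (`[0, +oo[%classic : set R) `*` [set: I])
  (f := fun zi : R * I => X zi.2 zi.1) (g := fun i => (z, i))) => //.
- by apply: measurableX => //; exact: measurable_itv.
- by move=> _ [i _ <-]; split => //=; rewrite in_itv/= z0.
- exact: measurable_fun_pair.
Qed.

Let mXpow z : 0 <= z -> measurable_fun [set: I] (fun i => X i z `^ alpha i).
Proof.
rewrite le_eqVlt => /predU1P[<-|z0].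
  rewrite (_ : (fun i => _) = cst 0)//; apply/funext => i.
  by rewrite in_B_at0 powR0// gt_eqF.
apply: measurable_fun_powR2 => //; first by move=> i; exact: in_B_gt0.
by apply: mX; exact: ltW.
Qed.

Let mcpow : measurable_fun [set: I] (fun i => c i `^ alpha i).
Proof. exact: measurable_fun_powR2. Qed.

Let mF z : 0 <= z -> measurable_fun [set: I] (F z).
Proof.
move=> z0; apply: measurable_funM => //.
by apply: measurable_maxr => //; exact: mXpow.
Qed.

Let integrable_ge0 (f : I -> R) : measurable_fun setT f -> (forall i, 0 <= f i) ->
  (\int[iota]_i (f i)%:E < +oo)%E -> iota.-integrable setT (EFin \o f).
Proof.
move=> mf f0 foo; apply/integrableP; split; first exact/measurable_EFinP.
rewrite (eq_integral (fun i => (f i)%:E)) // => i _ /=.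
by rewrite ger0_norm.
Qed.

(** The maximum is dominated by the sum of two integrable functions. At 0, where the class only
    bounds integrals for [z > 0], the integrand is [K]. *)
Let integrableF z : 0 <= z -> iota.-integrable setT (EFin \o F z).
Proof.
rewrite le_eqVlt => /predU1P[<-|z0].
  have -> : F 0 = K.
    apply/funext => i; rewrite /F in_B_at0 powR0 ?gt_eqF// max_l//.
    exact: powR_ge0.
  apply: integrable_ge0 kappa_fin; first exact: measurable_funM.
  by move=> i; exact/ltW/K_gt0.
have [_ /(_ z z0) Xoo _] := XB.
have iK : iota.-integrable setT (EFin \o K).
  apply: integrable_ge0 kappa_fin; first exact: measurable_funM.
  by move=> i; exact/ltW/K_gt0.
have iX : iota.-integrable setT (EFin \o (fun i => lambda i * X i z `^ alpha i)).
  apply: integrable_ge0 Xoo.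
    by apply: measurable_funM => //; apply: mXpow; exact: ltW.
  by move=> i; rewrite mulr_ge0 ?powR_ge0// ltW.
apply: (le_integrable measurableT _ _ (integrableD measurableT iK iX)).
  by apply/measurable_EFinP; apply: mF; exact: ltW.
move=> i _; rewrite lee_fin /= !ger0_norm.
- rewrite /K -mulrDr ler_pM2l// ge_max lerDl lerDr !powR_ge0//.
- by rewrite addr_ge0 ?mulr_ge0 ?powR_ge0// ltW.
- by rewrite ltW.
Qed.

Let J z := \int[iota]_i F z i.

Let J_le x y : 0 <= x -> x <= y -> J x <= J y.
Proof.
move=> x0 xy; apply: le_Rintegral => //; [exact: integrableF| |].
  by apply: integrableF; exact: le_trans xy.
by move=> i _; exact: F_le.
Qed.

(** If the integral were 0, its everywhere positive integrand would vanish almost everywhere,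
    against the positive total mass of [iota]. *)
Let J_gt0 z : 0 <= z -> 0 < J z.
Proof.
move=> z0; rewrite lt_neqAle eq_sym; apply/andP; split; last first.
  by apply: Rintegral_ge0 => i _; exact: ltW.
apply/negP => /eqP J0.
have /integrableP[mFz Foo] := integrableF z0.
have absF : (\int[iota]_i `|(F z i)%:E| = \int[iota]_i (F z i)%:E)%E.
  by apply: eq_integral => i _ /=; rewrite ger0_norm// ltW.
have : (\int[iota]_i `|(F z i)%:E| = 0)%E.
  rewrite absF -[LHS]fineK; last first.
    rewrite ge0_fin_numE; first by rewrite -absF.
    by apply: integral_ge0 => i _; rewrite lee_fin ltW.
  by move: J0; rewrite /J /Rintegral => ->.
move=> /(ae_eq_integral_abs iota measurableT mFz)[N [mN N0 sN]].
move: iotaT; rewrite ltNge => /negP; apply.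
rewrite -N0; apply: le_measure; rewrite ?inE// => i _; apply: sN => /=.
by move=> /(_ Logic.I)[] /eqP; rewrite gt_eqF.
Qed.

(** The absolute value extends the integrand evenly to the line, so that 0 becomes interior to the
    interval on which continuity under the integral is applied. *)
Let continuous_F i : continuous (fun z : R => F `|z| i).
Proof.
have -> : (fun z : R => F `|z| i) =
    (fun z : R => lambda i * (((c i + X i `|z|) + `|c i - X i `|z| |) / 2) `^ alpha i).
  by apply/funext => z; rewrite /F max_powR ?in_B_ge0 ?(ltW (c_gt0 i))// maxr_absE.
have cX : continuous (fun z : R => X i `|z|).
  apply: (@within_Rplus_comp _ (X i) (fun z : R => `|z|)) => //.
    exact: in_B_continuous.
  exact: norm_continuous.
move=> z; apply: cvgM; first exact: cvg_cst.
apply: (@continuous_cvg _ _ _ _ _ _ (fun y : R => y `^ alpha i)).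
  apply: continuous_powR; rewrite -maxr_absE.
  by rewrite lt_max c_gt0.
apply: cvgM; last exact: cvg_cst.
apply: cvgD; first by apply: cvgD; [exact: cvg_cst|exact: cX].
by apply: cvg_norm; apply: cvgB; [exact: cvg_cst|exact: cX].
Qed.

Let continuous_J : {within `[0, +oo[, continuous J}.
Proof.
have cJ : continuous (fun z : R => J `|z|).
  (* On the interval from [- M] to [M] the integrands are dominated by [F M], by monotonicity. *)
  move=> z; pose M := `|z| + 1.
  have M0 : 0 <= M by rewrite addr_ge0.
  have MP x : `]- M, M[%classic x -> `|x| <= M.
    by rewrite /= in_itv/= ler_norml => /andP[/ltW-> /ltW->].
  apply: (@continuity_under_integral R _ I iota (fun (z : R) i => F `|z| i) setT measurableT
    (- M) M _ _ (F M)).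
  - by move=> x _; exact: integrableF.
  - by apply: aeW => i _ x _; exact: continuous_F.
  - exact: integrableF.
  - move=> x /MP xM; apply: aeW => i _.
    by rewrite [leLHS]ger0_norm; [exact: F_le|exact: ltW].
  - by rewrite inE/= in_itv/= -ltr_norml ltrDl.
apply: (@subspace_eq_continuous _ _ _ (fun z : R => J `|z|)).
  by move=> z; rewrite inE/= in_itv/= andbT => z0; rewrite ger0_norm.
exact: continuous_subspaceT.
Qed.

Let scrI := opI iota c alpha lambda beta gamma X.

Let base_gt0 z : 0 <= z -> 0 < (1 + beta) * J z.
Proof. by move=> z0; rewrite mulr_gt0 ?J_gt0// addr_gt0. Qed.

Lemma opI_gt0 z : 0 <= z -> 0 < scrI z.
Proof. by move=> z0; apply: powR_gt0; exact: base_gt0. Qed.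

Lemma opI_noninc x y : 0 <= x -> x <= y -> scrI y <= scrI x.
Proof.
move=> x0 xy; have powRN_le (a b : R) : 0 < a -> a <= b -> b `^ (- gamma) <= a `^ (- gamma).
  move=> a0 ab; have b0 := lt_le_trans a0 ab.
  rewrite !powRN lef_pV2 ?posrE ?powR_gt0//.
  by apply: ge0_ler_powR; rewrite ?nnegrE ?(ltW gamma_gt0) ?(ltW a0) ?(ltW b0).
apply: powRN_le; first exact: base_gt0.
by apply: ler_wpM2l; [rewrite addr_ge0// ltW|exact: J_le].
Qed.

Lemma opI_continuous : {within `[0, +oo[, continuous scrI}.
Proof.
apply/subspace_continuousP => x; rewrite /= in_itv/= andbT => x0.
apply: (@continuous_cvg _ _ _ _ _ _ (fun y : R => y `^ (- gamma))).
  exact/continuous_powR/base_gt0.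
apply: cvgM; first exact: cvg_cst.
have /subspace_continuousP cJ := continuous_J.
by apply: cJ; rewrite /= in_itv/= x0.
Qed.

End opI_theory.

(** * The equation for the running supremum *)

Section running_supremum_equation.
Context {R : realType}.
Variables (beta : R) (f : R -> R).
Hypothesis beta_gt0 : 0 < beta.
Hypothesis f_gt0 : forall x, 0 <= x -> 0 < f x.
Hypothesis f_noninc : forall x y, 0 <= x -> x <= y -> f y <= f x.
Hypothesis f_cont : {within `[0, +oo[, continuous f}.
Let h p := p `^ (1 + beta) / f p.
Local Notation Rplus := (`[0, +oo[%classic : set R).
Local Notation q := (pinv Rplus h).

Let beta1 : 0 < 1 + beta. Proof. by rewrite addr_gt0. Qed.

Let powR_le (x y r : R) : 0 <= r -> 0 <= x -> x <= y -> x `^ r <= y `^ r.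
Proof.
move=> r0 x0 xy.
by apply: ge0_ler_powR; rewrite // nnegrE// (le_trans x0).
Qed.

Let powR_lt (x y : R) : 0 <= x -> x < y -> x `^ (1 + beta) < y `^ (1 + beta).
Proof.
move=> x0 xy; apply: gt0_ltr_powR; rewrite // nnegrE//.
by rewrite (le_trans x0)// ltW.
Qed.

Let rootK (x : R) : 0 <= x -> (x `^ (1 + beta)) `^ (1 + beta)^-1 = x.
Proof. by move=> x0; rewrite -powRrM mulfV ?gt_eqF// powRr1. Qed.

Let powRK (x : R) : 0 <= x -> (x `^ (1 + beta)^-1) `^ (1 + beta) = x.
Proof. by move=> x0; rewrite -powRrM mulVf ?gt_eqF// powRr1. Qed.

Lemma scaled_power_at0 : h 0 = 0.
Proof. by rewrite /h powR0 ?gt_eqF// mul0r. Qed.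

Lemma scaled_power_incr x y : 0 <= x -> x < y -> h x < h y.
Proof.
move=> x0 xy; have y0 := le_trans x0 (ltW xy).
apply: (@le_lt_trans _ _ (x `^ (1 + beta) / f y)).
  by rewrite ler_wpM2l ?powR_ge0// lef_pV2 ?posrE ?f_gt0// f_noninc// ltW.
by rewrite ltr_pM2r ?powR_lt// invr_gt0 f_gt0.
Qed.

Lemma scaled_power_cont : {within Rplus, continuous h}.
Proof.
have /continuous_within_itvcyP[fc fc0] := f_cont.
apply/continuous_within_itvcyP; split.
  move=> x; rewrite in_itv/= andbT => x0.
  apply: cvgM; first exact: continuous_powR.
  apply: cvgV; first by rewrite gt_eqF// f_gt0// ltW.
  by apply: fc; rewrite in_itv/= x0.
rewrite [X in _ --> X](_ : _ = 0 * (f 0)^-1); last by rewrite mul0r scaled_power_at0.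
apply: cvgM; first exact: powR_cvg0.
by apply: cvgV => //; rewrite gt_eqF// f_gt0.
Qed.

Lemma scaled_power_unbounded A : exists2 x, 0 <= x & A <= h x.
Proof.
have f0 := f_gt0 (lexx 0).
(* As [f <= f 0], one has [h x >= x ^ (1 + beta) / f 0]; the point is chosen so that the right-hand
   side is [Num.max A 0]. *)
pose y := Num.max A 0 * f 0.
have y0 : 0 <= y by rewrite mulr_ge0 ?(ltW f0)// le_max lexx orbT.
exists (y `^ (1 + beta)^-1); first exact: powR_ge0.
rewrite /h powRK//; apply: (@le_trans _ _ (y / f 0)).
  by rewrite /y mulfK ?gt_eqF// le_max lexx.
rewrite ler_wpM2l// lef_pV2 ?posrE ?f_gt0 ?powR_ge0//.
by apply: f_noninc => //; exact: powR_ge0.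
Qed.

Lemma scaled_power_bij : set_bij Rplus Rplus h.
Proof.
exact: (increasing_set_bij scaled_power_at0 scaled_power_incr scaled_power_cont
  scaled_power_unbounded).
Qed.

Let q_ge0 x : 0 <= x -> 0 <= q x.
Proof.
exact: (inverse_ge0 scaled_power_at0 scaled_power_incr scaled_power_cont
  scaled_power_unbounded).
Qed.

Let hq x : 0 <= x -> h (q x) = x.
Proof.
exact: (inverseK scaled_power_at0 scaled_power_incr scaled_power_cont
  scaled_power_unbounded).
Qed.

Let q_le x y : 0 <= x -> x <= y -> q x <= q y.
Proof.
exact: (inverse_le scaled_power_at0 scaled_power_incr scaled_power_cont
  scaled_power_unbounded).
Qed.

Let q_leP x p : 0 <= x -> 0 <= p -> (q x <= p) = (x <= h p).
Proof.
exact: (inverse_leP scaled_power_at0 scaled_power_incr scaled_power_cont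
  scaled_power_unbounded).
Qed.

Let phi x := f (q x).

Lemma scaled_power_inverseE x : 0 <= x -> x * phi x = q x `^ (1 + beta).
Proof.
move=> x0; rewrite -{1}(hq x0) /h /phi divfK// gt_eqF// f_gt0//.
exact: q_ge0.
Qed.

Lemma root_scaled_power_inverse x : 0 <= x -> (x * phi x) `^ (1 + beta)^-1 = q x.
Proof. by move=> x0; rewrite scaled_power_inverseE// rootK// q_ge0. Qed.

Let phi_gt0 x : 0 <= x -> 0 < phi x.
Proof. by move=> x0; rewrite f_gt0// q_ge0. Qed.

Let phi_noninc x y : 0 <= x -> x <= y -> phi y <= phi x.
Proof. by move=> x0 xy; apply: f_noninc; [exact: q_ge0|exact: q_le]. Qed.

Section processes.
Context {d : measure_display} {Omega : measurableType d}.
Variables (Pr : probability Omega R) (F : R -> set (set Omega)).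
Variable X : R -> Omega -> R.
Hypothesis filF : filtration F.
Hypothesis complF : complete_filtration Pr F.
Hypothesis progX : progressive F X.
Hypothesis posX : positive_process X.
Hypothesis bddX : locally_bounded_above X.

Let positive_run_sup (Y : R -> Omega -> R) t w : positive_process Y ->
  locally_bounded_above Y -> 0 <= t -> 0 < run_sup Y t w.
Proof.
move=> posY bddY t0; apply: lt_le_trans (posY t w t0) _.
by apply: run_sup_ge; [exact: bddY|rewrite t0 lexx].
Qed.

Lemma solves_run_sup P t w : solves F beta f X P -> 0 <= t ->
  run_sup P t w = q (run_sup X t w).
Proof.
move=> [_ posP bddP PE] t0.
have Xt := positive_run_sup w posX bddX t0.
have Pt := positive_run_sup w posP bddP t0.
have XE s : 0 <= s -> X s w = P s w `^ (1 + beta) / f (run_sup P s w).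
  by move=> s0; rewrite PE// mulfK// gt_eqF// f_gt0// ltW// positive_run_sup.
apply/le_anti/andP; split.
  apply/run_sup_le => //; first exact: bddP.
  move=> s /andP[s0 st]; have Ps := positive_run_sup w posP bddP s0.
  (* Applying [h] would give [run_sup X t w < h (P s w)]. Yet [h (P s w) <= X s w], as [f] is at
     least as large at [P s w] as at the running supremum. *)
  rewrite leNgt; apply/negP => qP.
  have := scaled_power_incr (q_ge0 (ltW Xt)) qP; rewrite hq ?ltW//.
  apply/negP; rewrite -leNgt; apply: (@le_trans _ _ (X s w)); last first.
    by apply: run_sup_ge; [exact: bddX|rewrite s0].
  rewrite XE// ler_wpM2l ?powR_ge0// lef_pV2 ?posrE ?f_gt0 ?(ltW Ps) ?(ltW (posP _ _ s0))//.
  apply: f_noninc; first exact/ltW/posP.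
  by apply: run_sup_ge; [exact: bddP|rewrite s0 lexx].
rewrite (q_leP (ltW Xt) (ltW Pt)); apply/run_sup_le => //; first exact: bddX.
move=> s /andP[s0 st]; have Ps := positive_run_sup w posP bddP s0.
apply: (@le_trans _ _ (h (run_sup P s w))).
  rewrite XE// ler_wpM2r ?invr_ge0 ?(ltW (f_gt0 _)) ?(ltW Ps)//.
  apply: powR_le; rewrite ?(ltW beta1) ?(ltW (posP _ _ s0))//.
  by apply: run_sup_ge; [exact: bddP|rewrite s0 lexx].
have : run_sup P s w <= run_sup P t w by apply: le_run_sup => //; exact: bddP.
rewrite le_eqVlt => /predU1P[->//|PsPt].
by apply/ltW/scaled_power_incr => //; exact: ltW.
Qed.

Let P0 t w := (X t w * phi (run_sup X t w)) `^ (1 + beta)^-1.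

Lemma solves_unique P t w : solves F beta f X P -> 0 <= t -> P t w = P0 t w.
Proof.
move=> sP t0; have [_ posP _ PE] := sP.
by rewrite /P0 /phi -(solves_run_sup w sP t0) -PE// rootK// ltW// posP.
Qed.

Let Xphi_gt0 t w : 0 <= t -> 0 < X t w * phi (run_sup X t w).
Proof.
move=> t0; rewrite mulr_gt0 ?posX// phi_gt0//.
by apply/ltW; exact: positive_run_sup.
Qed.

Let P0_le s t w : 0 <= s -> s <= t -> P0 s w <= q (run_sup X t w).
Proof.
move=> s0 st; have Xs := positive_run_sup w posX bddX s0.
apply: (@le_trans _ _ (q (run_sup X s w))); last first.
  apply: q_le; first exact: ltW.
  by apply: le_run_sup => //; apply: bddX; exact: le_trans st.
rewrite -(root_scaled_power_inverse (ltW Xs)); apply: powR_le.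
- by rewrite invr_ge0 ltW.
- by apply/ltW/Xphi_gt0.
- rewrite ler_wpM2r ?(ltW (phi_gt0 _)) ?(ltW Xs)//.
  by apply: run_sup_ge; [exact: bddX|rewrite s0 lexx].
Qed.

Let bddP0 : locally_bounded_above P0.
Proof.
move=> t w t0; exists (q (run_sup X t w)) => _ [s + <-].
by rewrite /= in_itv/= => /andP[s0 st]; exact: P0_le.
Qed.

(** For the lower bound, [X s w * phi (run_sup X t w)] is at most [P0 s w ^ (1 + beta)] because
    [phi] is nonincreasing; the supremum over [s] then yields [q (run_sup X t w) ^ (1 + beta)] on
    the left. *)
Let run_sup_P0 t w : 0 <= t -> run_sup P0 t w = q (run_sup X t w).
Proof.
move=> t0; have Xt := positive_run_sup w posX bddX t0.
apply/le_anti/andP; split.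
  apply/run_sup_le => //; first exact: bddP0.
  by move=> s /andP[s0 st]; exact: P0_le.
have posP0 : positive_process P0 by move=> s v s0; apply: powR_gt0; exact: Xphi_gt0.
have P0t := positive_run_sup w posP0 bddP0 t0.
rewrite -(root_scaled_power_inverse (ltW Xt)) -[leRHS](rootK (ltW P0t)).
apply: powR_le; first by rewrite invr_ge0 ltW.
  by rewrite mulr_ge0 ?(ltW Xt)// ltW// phi_gt0// ltW.
rewrite -ler_pdivlMr ?phi_gt0 ?(ltW Xt)//.
apply/run_sup_le => //; first exact: bddX.
move=> s /andP[s0 st]; rewrite ler_pdivlMr ?phi_gt0 ?(ltW Xt)//.
have Xs := positive_run_sup w posX bddX s0.
apply: (@le_trans _ _ (X s w * phi (run_sup X s w))).
  rewrite ler_wpM2l ?(ltW (posX _ _))//; apply: phi_noninc; first exact: ltW.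
  by apply: le_run_sup => //; exact: bddX.
rewrite -[leLHS]powRK ?(ltW (Xphi_gt0 _ _))//; apply: powR_le => //; first exact: ltW.
  exact: powR_ge0.
by apply: (run_sup_ge (bddP0 w t0)); rewrite s0.
Qed.

Lemma solves_root : solves F beta f X P0.
Proof.
split.
- move=> t t0; have [sF _ _] := filF.
  apply: (measurableT_comp (f := fun x : R => x `^ (1 + beta)^-1)).
    exact: measurable_powR.
  apply: measurable_funM; first exact: progX.
  have pXs := progressive_run_sup filF complF bddX progX t0.
  (* Truncation at 0 makes [phi] monotone on the whole line, hence measurable. *)
  apply: (eq_measurable_fun (fun sw : R * g_sigma_algebraType (F t) =>
      phi (Num.max 0 (run_sup X sw.1 sw.2)))).
    move=> [s w]; rewrite inE => -[/=]; rewrite in_itv/= => /andP[s0 _] _.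
    by rewrite max_r// ltW// positive_run_sup.
  apply: (measurableT_comp (f := fun x : R => phi (Num.max 0 x))) => //.
  apply: nonincreasing_measurable => // x y xy; apply: phi_noninc.
    by rewrite le_max lexx.
  by rewrite ge_max !le_max lexx xy orbT.
- by move=> t w t0; apply: powR_gt0; exact: Xphi_gt0.
- exact: bddP0.
- by move=> t w t0; rewrite run_sup_P0// powRK// ltW// Xphi_gt0.
Qed.

End processes.
End running_supremum_equation.

(** * Transfer from [Psi] to [Phi], and assembly of the two statements *)

Lemma eq_diff_of_convex (R : realType) (f g : R -> R) :
  (forall z, 0 <= z -> f z = g z) -> diff_of_convex f -> diff_of_convex g.
Proof.
move=> fg [a [b [ca cb fE]]]; exists a, b; split => // z z0.
by rewrite -fg// fE.
Qed.

Lemma near_eq_left_derivative_gt0 (R : realType) (f g : R -> R) (x : R) : 0 < x ->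
  (forall z, 0 <= z -> f z = g z) ->
  left_derivative_gt0 f x -> left_derivative_gt0 g x.
Proof.
move=> x0 fg [l l0 hf]; exists l => //.
apply: near_eq_left_derivative hf; first by rewrite fg// ltW.
near=> y; apply/fg/ltW; near: y; exact: nbhs_left_gt.
Unshelve. all: by end_near. Qed.

(** [Phi i] agrees with [Psi i \o q] only on the half-line, so each clause is transported along this
    partial equality. Joint measurability uses that [q (Num.max 0 z)] is monotone in [z]. *)
Lemma in_B_comp {d : measure_display} {I : measurableType d} {R : realType}
    (iota : {measure set I -> \bar R}) (alpha lambda : I -> R)
    (Psi Phi : I -> R -> R) (q : R -> R) :
  in_B iota alpha lambda Psi ->
  q 0 = 0 -> (forall x y, 0 <= x -> x < y -> q x < q y) ->
  {within `[0, +oo[, continuous q} -> q x @[x --> +oo] --> +oo ->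
  (forall i, diff_of_convex (Psi i \o q)) ->
  (forall i x, 0 < x -> left_derivative_gt0 (Psi i \o q) x) ->
  (forall i x, 0 <= x -> Phi i x = Psi i (q x)) ->
  in_B iota alpha lambda Phi.
Proof.
move=> PsiB q0 qlt qc qy dcPhi ldPhi PhiE.
have qle x y : 0 <= x -> x <= y -> q x <= q y.
  by move=> x0; rewrite le_eqVlt => /predU1P[->//|/(qlt _ _ x0)/ltW].
have q_ge0 x : 0 <= x -> 0 <= q x by move=> /(qle _ _ (lexx 0)); rewrite q0.
have [mPsi iPsi pPsi] := PsiB; split.
- have mD : measurable ((`[0, +oo[%classic : set R) `*` [set: I]).
    by apply: measurableX => //; exact: measurable_itv.
  apply: (eq_measurable_fun (fun zi : R * I => Psi zi.2 (q (Num.max 0 zi.1)))).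
    move=> [z i]; rewrite inE => -[/= + _]; rewrite in_itv/= andbT => z0.
    by rewrite max_r// PhiE.
  apply: (measurable_comp (F := (`[0, +oo[%classic : set R) `*` [set: I])
    (f := fun zi : R * I => Psi zi.2 zi.1)
    (g := fun zi : R * I => (q (Num.max 0 zi.1), zi.2))) => //.
    move=> _ [[z i] _ <-]; split => //=; rewrite in_itv/= andbT.
    by apply: q_ge0; rewrite le_max lexx.
  apply: measurable_funTS; apply: measurable_fun_pair => //.
  apply: (measurableT_comp (f := fun x : R => q (Num.max 0 x))) => //.
  apply: nondecreasing_measurable => // x y xy; apply: qle.
    by rewrite le_max lexx.
  by rewrite ge_max !le_max lexx xy orbT.
- move=> z z0; under eq_integral do rewrite PhiE ?ltW//.
  by apply: iPsi; have := qlt _ _ (lexx 0) z0; rewrite q0.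
- move=> i; have PhiE' z : 0 <= z -> (Psi i \o q) z = Phi i z.
    by move=> z0; rewrite PhiE.
  split.
  + exact: eq_diff_of_convex (dcPhi i).
  + have [/continuous_within_itvcyP[_ /= Psiq0] _] := diff_of_convex_intercept (dcPhi i).
    rewrite q0 (in_B_at0 PsiB) in Psiq0.
    apply: cvg_trans Psiq0; apply: near_eq_cvg; near=> z; apply: PhiE'.
    by near: z; exact: nbhs_right_ge.
  + have [_ _ Psiy _] := pPsi i.
    have := @cvg_comp _ _ _ q (Psi i) _ _ _ qy Psiy.
    apply: cvg_trans; apply: near_eq_cvg; near=> z; apply: PhiE'.
    by near: z; apply: nbhs_pinfty_ge; exact: num_real.
  + by move=> z z0; apply: near_eq_left_derivative_gt0 PhiE' _ => //; exact: ldPhi.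
Unshelve. all: by end_near. Qed.

(** The evaluation points may differ: with [hinv x] for [Psi] and [x] for [Phi], this is the
    identity between [phi] and the operator at [Phi]. *)
Lemma eq_opI {d : measure_display} {I : measurableType d} {R : realType}
    (iota : {measure set I -> \bar R}) (c alpha lambda : I -> R) (beta gamma : R)
    (X Y : I -> R -> R) (x y : R) : (forall i, X i x = Y i y) ->
  opI iota c alpha lambda beta gamma X x = opI iota c alpha lambda beta gamma Y y.
Proof.
move=> XY.
have E : \int[iota]_i (lambda i * Num.max (c i `^ alpha i) (X i x `^ alpha i)) =
    \int[iota]_i (lambda i * Num.max (c i `^ alpha i) (Y i y `^ alpha i)).
  by apply: eq_Rintegral => i _; rewrite XY.
by rewrite /opI E.
Qed.

(** That [scrI Psi] is a difference of convex functions serves to differentiate [hinv] from the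
    left. Completeness enters through the projection theorem, positive mass of [iota] through
    positivity of the operator, and local boundedness makes the suprema of [X] finite. *)
Theorem theorem5p2 (R : realType)
  (dO : measure_display) (Omega : measurableType dO)
  (Pr : probability Omega R) (F : R -> set (set Omega))
  (W : R -> Omega -> R)
  (dI : measure_display) (I : measurableType dI)
  (iota : {measure set I -> \bar R})
  (beta delta : R) (c alpha lambda : I -> R)
  (Psi : I -> R -> R) (X : R -> Omega -> R) :
  filtration F -> complete_filtration Pr F -> brownian_motion Pr F W ->
  sigma_finite [set: I] iota -> non_atomic iota -> (0 < iota [set: I])%E ->
  0 < beta -> 0 < delta ->
  let gamma := (1 + beta) / (delta + beta) in
  0 < gamma < 1 ->
  measurable_fun [set: I] c -> measurable_fun [set: I] alpha ->
  measurable_fun [set: I] lambda ->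
  (forall i, 0 < c i) -> (forall i, 0 < alpha i < 1) ->
  (forall i, 0 < lambda i) ->
  ((1 + beta)%:E * \int[iota]_i (lambda i * c i `^ alpha i)%:E < +oo)%E ->
  in_B iota alpha lambda Psi ->
  progressive F X -> positive_process X -> locally_bounded_above X ->
  let scrI := opI iota c alpha lambda beta gamma in
  let h p := p `^ (1 + beta) / scrI Psi p in
  let hinv := pinv (`[0, +oo[%classic : set R) h in
  let phi x := scrI Psi (hinv x) in
  let Phi i x := Psi i ((x * phi x) `^ (1 + beta)^-1) in
  let P0 t w := (X t w * scrI Phi (run_sup X t w)) `^ (1 + beta)^-1 in
  (* h is a bijection of [0, +oo[, so that hinv is its inverse *)
  set_bij (`[0, +oo[%classic : set R) (`[0, +oo[%classic : set R) h /\
  (* (I) *)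
  [/\ diff_of_convex (scrI Psi) ->
        in_B iota alpha lambda Phi /\
        (forall x, 0 < x -> left_derivative_gt0 (fun y => y * phi y) x),
      forall x, 0 <= x -> phi x = scrI Phi x &
      x * phi x @[x --> +oo] --> +oo] /\
  (* (II) *)
  (solves F beta (scrI Psi) X P0 /\
   forall P, solves F beta (scrI Psi) X P ->
     forall t w, 0 <= t -> P t w = P0 t w).
Proof.
move=> filF complF _ _ _ iotaT beta0 _ gamma /andP[gamma0 _] mc malpha mlambda c0.
move=> alpha01 lambda0 kappa PsiB progX posX bddX scrI h hinv phi Phi P0.
have alpha0 i : 0 < alpha i by have /andP[] := alpha01 i.
have beta1 : 0 < 1 + beta by rewrite addr_gt0.
have kappa_fin : (\int[iota]_i (lambda i * c i `^ alpha i)%:E < +oo)%E.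
  move: kappa; rewrite !ltey; apply: contra => /eqP ->.
  by rewrite gt0_muley// lte_fin.
have f_gt0 : forall x, 0 <= x -> 0 < scrI Psi x by move=> x x0; exact: opI_gt0.
have f_noninc : forall x y, 0 <= x -> x <= y -> scrI Psi y <= scrI Psi x.
  by move=> x y x0 xy; exact: opI_noninc.
have f_cont : {within `[0, +oo[, continuous (scrI Psi)} by exact: opI_continuous.
have h0 : h 0 = 0 by exact: scaled_power_at0.
have hlt : forall x y, 0 <= x -> x < y -> h x < h y by exact: scaled_power_incr.
have hc : {within `[0, +oo[, continuous h} by exact: scaled_power_cont.
have hy : forall A, exists2 x, 0 <= x & A <= h x by exact: scaled_power_unbounded.
have q_ge0 x : 0 <= x -> 0 <= hinv x by exact: inverse_ge0.
have q_lt x y : 0 <= x -> x < y -> hinv x < hinv y by exact: inverse_lt.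
have q_at0 : hinv 0 = 0 by exact: inverse_at0.
have q_cont : {within `[0, +oo[, continuous hinv} by exact: inverse_continuous.
have q_y : hinv x @[x --> +oo] --> +oo by exact: inverse_cvgy.
have hq x : 0 <= x -> h (hinv x) = x by exact: inverseK.
have q_gt0 x : 0 < x -> 0 < hinv x by exact: inverse_gt0.
have xphiE x : 0 <= x -> x * phi x = hinv x `^ (1 + beta).
  exact: scaled_power_inverseE.
have PhiE i x : 0 <= x -> Phi i x = Psi i (hinv x).
  by move=> x0; congr (Psi i _); exact: root_scaled_power_inverse.
have phiE x : 0 <= x -> phi x = scrI Phi x.
  by move=> x0; apply: eq_opI => i; exact/esym/PhiE.
have P0E t w : 0 <= t -> P0 t w = (X t w * phi (run_sup X t w)) `^ (1 + beta)^-1.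
  move=> t0; rewrite /P0 phiE// ltW//; apply: lt_le_trans (posX t w t0) _.
  by apply: run_sup_ge; [exact: bddX|rewrite t0 lexx].
split; first exact: scaled_power_bij.
split; [split|split].
- move=> dcI.
  have I_gt0 x : 0 < x -> 0 < scrI Psi x by move=> x0; exact/f_gt0/ltW.
  have I_noninc x y : 0 < x -> x <= y -> scrI Psi y <= scrI Psi x.
    by move=> x0; exact/f_noninc/ltW.
  have q_lt' x y : 0 < x -> x < y -> hinv x < hinv y by move=> x0; exact/q_lt/ltW.
  have hq' x : 0 < x -> hinv x `^ (1 + beta) / scrI Psi (hinv x) = x.
    by move=> x0; exact/hq/ltW.
  split.
    have [_ _ pPsi] := PsiB.
    apply: (in_B_comp PsiB) PhiE => //.
      move=> i; have [dcPsi _ _ _] := pPsi i.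
      apply: (diff_of_convex_comp_inverse beta0 dcI) => //.
        by move=> x x0; apply/ltW/(in_B_gt0 PsiB).
      by move=> x y x0 xy; apply: (in_B_nondecreasing PsiB) => //; exact: ltW.
    move=> i x x0; have [_ _ _ ldPsi] := pPsi i.
    apply: (left_derivative_gt0_comp_inverse beta0 dcI) => //.
    exact/ldPsi/q_gt0.
  move=> x x0.
  (* Since [x * phi x = hinv x ^ (1 + beta)], the chain rule applies to a power of [hinv]. *)
  apply: (@near_eq_left_derivative_gt0 _ ((fun p => p `^ (1 + beta)) \o hinv)) => //.
    by move=> z z0; rewrite xphiE.
  apply: (left_derivative_gt0_comp_inverse beta0 dcI) => //.
  exists ((1 + beta) * hinv x `^ (1 + beta - 1)).
    by rewrite mulr_gt0// powR_gt0// q_gt0.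
  exact/left_derivative_powR/q_gt0.
- exact: phiE.
- apply/cvgryPge => A; near=> x.
  have x0 : 0 <= x by near: x; apply: nbhs_pinfty_ge; exact: num_real.
  (* The bound by 1 ensures [hinv x <= hinv x ^ (1 + beta)]. *)
  have : Num.max 1 A <= hinv x by near: x; move/cvgryPge: q_y; exact.
  rewrite ge_max => /andP[q1 qA]; rewrite xphiE//.
  by apply: le_trans qA _; apply: le1r_powR => //; rewrite lerDl ltW.
- have [prog pos bdd eqn] :=
    solves_root beta0 f_gt0 f_noninc f_cont filF complF progX posX bddX.
  have supE t w : 0 <= t -> run_sup P0 t w =
      run_sup (fun t w => (X t w * phi (run_sup X t w)) `^ (1 + beta)^-1) t w.
    by move=> t0; apply: eq_run_sup => s /andP[s0 _]; exact: P0E.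
  split.
  + move=> t t0; apply: eq_measurable_fun (prog t t0) => -[s w].
    by rewrite inE => -[/= + _]; rewrite in_itv/= => /andP[s0 _]; rewrite P0E.
  + by move=> t w t0; rewrite P0E//; exact: pos.
  + move=> t w t0; have [M MP] := bdd t w t0; exists M => _ [s st <-].
    rewrite P0E; first by apply: MP; exists s.
    by move: st; rewrite /= in_itv/= => /andP[].
  + by move=> t w t0; rewrite supE// P0E//; exact: eqn.
- by move=> P sP t w t0; rewrite P0E//;
  exact: (solves_unique beta0 f_gt0 f_noninc f_cont posX bddX w sP t0).
Unshelve. all: by end_near. Qed.
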